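(* Let $t>0$ be fixed, let $B=\{B_s\}_{s\ge 0}$ be a one-dimensional standard Brownian motion, and fix $z\in\mathbb{R}$. For every nonnegative measurable functional $F$ on $C([0,t];\mathbb{R})$, we have $$\mathbb{E}\left[F\bigl(\mathbb{T}_z(B)(s),s\le t\bigr)\right]=\mathbb{E}\left[\exp\left\{\frac{\cosh B_t-\cosh(z+B_t)}{Z_t}\right\}F(B_s,s\le t)\right],$$ or, equivalently, $$\mathbb{E}\left[F(B_s,s\le t)\right]=\mathbb{E}\left[\exp\left\{\frac{\cosh B_t-\cosh(z+B_t)}{Z_t}\right\}F\bigl(\mathbb{T}_{-z}(B)(s),s\le t\bigr)\right].$$
   Context: For a continuous function $\phi$ on $[0,t]$ (or on $[0,\infty)$) put $A_s(\phi)=\int_0^s e^{2\phi_u}\,du$ and $Z_s(\phi)=e^{-\phi_s}A_s(\phi)$; write $A_s=A_s(B)$ and $Z_s=Z_s(B)$. For $z\in\mathbb{R}$, the path transformation $\mathbb{T}_z:C([0,t];\mathbb{R})\to C([0,t];\mathbb{R})$ is defined by $$\mathbb{T}_z(\phi)(s)=\phi_s-\log\left\{1+\frac{A_s(\phi)}{A_t(\phi)}(e^z-1)\right\},\quad 0\le s\le t.$$ Brownian motions start from $0$. The space $C([0,t];\mathbb{R})$ of real-valued continuous functions on $[0,t]$ carries the topology of uniform convergence, and functionals on it are measurable if they are Borel-measurable. *)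

(* Defs.v *)
From HB Require Import structures.
From mathcomp Require Import all_boot all_order all_algebra.
From mathcomp Require Import all_classical all_reals all_analysis.

Set Implicit Arguments.
Unset Strict Implicit.
Unset Printing Implicit Defensive.

Import Order.TTheory GRing.Theory Num.Theory.
Import numFieldNormedType.Exports.
Import ArrowAsUniformType.

Local Open Scope classical_set_scope.
Local Open Scope ring_scope.

Definition cosh {R : realType} (x : R) : R := (expR x + expR (- x)) / 2.

(* [ArrowAsUniformType] equips [continuousType] with the topology of uniform
   convergence. *)
Definition cpath {R : realType} (t : R) : Type :=
  continuousType (set_type `[0, t]) R.

HB.instance Definition _ (R : realType) (t : R) :=
  Uniform.copy (cpath t) (continuousType (set_type `[0, t]) R).

HB.instance Definition _ (R : realType) (t : R) :=
  isPointed.Build (cpath t) (cst 0 : continuousType (set_type `[0, t]) R).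

Definition borel_cpath {R : realType} (t : R) :=
  g_sigma_algebraType (@open (cpath t)).

(* The coordinates of a path; the value 0 outside [0, t] is never used. *)
Definition cpath_fun {R : realType} (t : R) (phi : cpath t) : R -> R :=
  'valL_0 (phi : continuousType (set_type `[0, t]) R).

Definition expA {R : realType} (phi : R -> R) (s : R) : R :=
  \int[lebesgue_measure]_(u in `[0, s]) expR (2 * phi u).

Definition expZ {R : realType} (phi : R -> R) (s : R) : R :=
  expR (- phi s) * expA phi s.

Definition transform_fun {R : realType} (t z : R) (phi : cpath t)
    (s : set_type `[0, t]) : R :=
  let f := cpath_fun phi in
  f (set_val s) - ln (1 + expA f (set_val s) / expA f t * (expR z - 1)).

Section transform_continuous.
Context {R : realType}.
Implicit Types (t z : R).

Lemma cpath_fun_continuous t (phi : cpath t) :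
  {within `[0, t], continuous (cpath_fun phi)}.
Proof. by apply/subspace_valL_continuousP'; exact: cts_fun. Qed.

Lemma exp2_continuous t (phi : cpath t) :
  {within `[0, t], continuous (fun u => expR (2 * cpath_fun phi u))}.
Proof.
have c2 : continuous (fun x : R => expR (2 * x)).
  move=> y; apply: (@continuous_comp _ _ _ (fun x : R => 2 * x) expR).
    exact: mulrl_continuous.
  exact: continuous_expR.
apply: (@within_continuous_comp _ _ _ _ (cpath_fun phi)
  (fun x : R => expR (2 * x))); last exact: cpath_fun_continuous.
by move=> x _; exact: c2.
Qed.

Lemma exp2_integrable t (phi : cpath t) :
  (@lebesgue_measure R).-integrable `[0, t]
    (EFin \o (fun u => expR (2 * cpath_fun phi u))).
Proof.
apply: continuous_compact_integrable; first exact: segment_compact.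
exact: exp2_continuous.
Qed.

Lemma expA_continuous t (phi : cpath t) : 0 <= t ->
  {within `[0, t], continuous (expA (cpath_fun phi))}.
Proof.
move=> t0; exact: (parameterized_integral_continuous t0 (exp2_integrable phi)).
Qed.

Lemma expA_ge0 (f : R -> R) s : 0 <= expA f s.
Proof. by apply: Rintegral_ge0 => x _; exact: expR_ge0. Qed.

Lemma expA_le t (phi : cpath t) s : s <= t ->
  expA (cpath_fun phi) s <= expA (cpath_fun phi) t.
Proof.
move=> st; rewrite /expA /Rintegral; apply: fine_le.
- rewrite integrable_fin_num//.
  by apply: (integrableS _ _ _ (exp2_integrable phi)) => //;
    exact: subset_itvl.
- by rewrite integrable_fin_num//; exact: exp2_integrable.
apply: ge0_subset_integral => //.
  by have /measurable_int := exp2_integrable phi.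
exact: subset_itvl.
Qed.

Lemma transform_arg_gt0 t z (phi : cpath t) s : s <= t ->
  let f := cpath_fun phi in
  0 < 1 + expA f s / expA f t * (expR z - 1).
Proof.
move=> st /=; set r := _ / _.
have r0 : 0 <= r by rewrite divr_ge0 ?expA_ge0.
have r1 : r <= 1.
  have [t0|tn0] := eqVneq (expA (cpath_fun phi) t) 0.
    by rewrite /r t0 invr0 mulr0.
  rewrite /r ler_pdivrMr ?mul1r ?expA_le//.
  by rewrite lt_neqAle eq_sym tn0 expA_ge0.
have -> : 1 + r * (expR z - 1) = (1 - r) + r * expR z.
  by rewrite mulrBr mulr1 addrA addrAC.
have [->|rn0] := eqVneq r 0; first by rewrite subr0 mul0r addr0.
apply: ltr_wpDl; first by rewrite subr_ge0.
by rewrite mulr_gt0 ?expR_gt0// lt_neqAle eq_sym rn0.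
Qed.

Lemma transform_continuous t z (phi : cpath t) :
  continuous (transform_fun z phi).
Proof.
move=> s; have /andP[s0 st] : 0 <= set_val s <= t.
  by have := set_valP s; rewrite /= in_itv.
have t0 := le_trans s0 st.
pose f := cpath_fun phi.
have /subspace_sigL_continuousP cf := @cpath_fun_continuous t phi.
have /subspace_sigL_continuousP cA := @expA_continuous t phi t0.
apply: (cvgB (cf s)).
apply: (@continuous_comp _ _ _
  (fun u : set_type `[0, t] =>
    1 + expA f (set_val u) / expA f t * (expR z - 1)) (@ln R)); last first.
  exact/continuous_ln/transform_arg_gt0.
exact: (cvgD (cvg_cst _) (cvgMr_tmp (cvgMr_tmp (cA s)))).
Qed.

End transform_continuous.

Definition transform {R : realType} (t z : R) (phi : cpath t) : cpath t :=
  mkcts (@transform_continuous R t z phi).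

Definition independent_RVs {d} {T : measurableType d} {R : realType}
    (P : probability T R) (n : nat) (X : 'I_n -> T -> R) : Prop :=
  forall (J : {set 'I_n}) (A : 'I_n -> set R), (forall i, measurable (A i)) ->
    (P (\bigcap_(i in [set` J]) (X i @^-1` A i)) =
     \prod_(i in J) P (X i @^-1` A i))%E.

(* Times s < 0 are unconstrained: only the restriction of the process to
   [0, +oo) matters. The second parameter of [normal_prob] is the standard
   deviation. *)
Record brownian_motion {d} {T : measurableType d} {R : realType}
    (P : probability T R) := BrownianMotion {
  bm_process :> R -> T -> R ;
  bm_measurable : forall s, 0 <= s -> measurable_fun [set: T] (bm_process s) ;
  bm_start : {ae P, forall w, bm_process 0 w = 0} ;
  bm_continuous :
    forall w, {within `[0, +oo[, continuous (fun s => bm_process s w)} ;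
  bm_gaussian : forall s u, 0 <= s -> s < u ->
    forall A : set R, measurable A ->
      P ((fun w => bm_process u w - bm_process s w) @^-1` A) =
      normal_prob 0 (Num.sqrt (u - s)) A ;
  bm_independent : forall (n : nat) (s : nat -> R),
    0 <= s 0%N -> (forall i, (i < n)%N -> s i <= s i.+1) ->
    independent_RVs P
      (fun (i : 'I_n) w => bm_process (s i.+1) w - bm_process (s i) w) }.

Lemma bm_path_continuous {d} {T : measurableType d} {R : realType}
    {P : probability T R} (B : brownian_motion P) (t : R) (w : T) :
  continuous (sigL `[0, t] (fun s => B s w)).
Proof.
apply/subspace_sigL_continuousP.
have sub : `[0, t] `<=` (`[0, +oo[ : set R).
  by move=> s /=; rewrite !in_itv/= => /andP[->].
exact: (continuous_subspaceW sub (@bm_continuous d T R P B w)).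
Qed.

Definition bm_path {d} {T : measurableType d} {R : realType}
    {P : probability T R} (B : brownian_motion P) (t : R) (w : T) : cpath t :=
  mkcts (@bm_path_continuous d T R P B t w).

(* Main.v *)
From HB Require Import structures.
Require Import Defs.
From mathcomp Require Import all_boot all_order all_algebra.
From mathcomp Require Import all_classical all_reals all_analysis.
From mathcomp Require Import measurable_realfun ring lra.

(* Discretise time with mesh [dt] and replace [A] by the sums
   [A_(i+1) = A_i + dt * exp (phi_i + phi_(i+1))].  With this choice the discrete
   transformation keeps every [Z_i = exp (- phi_i) * A_i] and moves the endpoint
   [phi_n] to [phi_n - z].  The coordinates [(ln Z_2, ..., ln Z_n, phi_n)] are
   obtained from [(phi_1, ..., phi_n)] by successive shears, so the discrete
   transformation preserves Lebesgue measure.  Moreover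
   [\sum_i cosh (phi_(i+1) - phi_i) / dt - cosh phi_n / Z_n] is invariant, hence
   replacing [x^2 / 2] by [cosh x - 1] in the Gaussian weight of the increments
   gives exactly the density of the theorem.  The error made is bounded below by
   [- X Q], where [Q] is the quadratic variation along the grid, of bounded
   expectation, and [X] tends to 0 on every continuous path.  Letting the mesh
   tend to 0 yields [E (min (D_z, K) F(B)) <= E (F(T_z B))]; the reverse
   inequality is the same one for [-z], because [D_(-z) * D_z o T_(-z) = 1].
   Products of continuous functions of finitely many coordinates determine
   finite measures on [C[0,t]], which concludes. *)

Set Implicit Arguments.
Unset Strict Implicit.
Unset Printing Implicit Defensive.

Import Order.TTheory GRing.Theory Num.Theory.
Import numFieldNormedType.Exports.

Local Open Scope classical_set_scope.
Local Open Scope ring_scope.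

(** The discrete formulas are exact because, with [w_i = 1 + A_i / A_n * (exp z - 1)], the
    transformed summand of [A] has denominator [w_i * w_(i+1)] and is, up to a constant factor, a
    difference of consecutive values of [1 / w]. The energy [cosh], built from [exp] of an increment
    and its inverse, is compatible with this.

    The obstacle is the mesh limit: the Gaussian density ratio is not bounded, and the quadratic
    variation is controlled only in mean. Hence an inequality is aimed at: convexity bounds the
    log-ratio from below with an error linear in the change of the increments, the cap [K] makes
    bounded convergence applicable, and large values of [Q] cost at most a multiple of its mean. [X]
    tends to 0 because the transformation changes each increment by [O(dt)], which leaves one small
    factor, the increment itself.

    There is no coordinate [ln Z_1] because [Z_1 = dt] is constant. A Brownian motion starts from 0
    only almost surely here, so the discretisation runs on [B - B_0], and [B_0 = 0] enters when the
    identity is transferred to [B]. *)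

Section weighted_pushforward.
Context d (T : measurableType d) d' (S : measurableType d') (R : realType).
Variables (mu : {measure set T -> \bar R}) (f : T -> S) (g : T -> R).
Hypotheses (mf : measurable_fun setT f) (mg : measurable_fun setT g).
Hypothesis g0 : forall x, 0 <= g x.
Local Open Scope ereal_scope.

Let nu (A : set S) := \int[mu]_(x in f @^-1` A) (g x)%:E.

Let mfA (A : set S) : measurable A -> measurable (f @^-1` A).
Proof. by move=> mA; rewrite -[X in measurable X]setTI; exact: mf. Qed.

Let mgE D : measurable_fun D (EFin \o g).
Proof. by apply/measurable_EFinP; exact: measurable_funTS. Qed.

Let nu0 : nu set0 = 0.
Proof. by rewrite /nu preimage_set0 integral_set0. Qed.

Let nu_ge0 A : 0 <= nu A.
Proof. by apply: integral_ge0 => x _; rewrite lee_fin. Qed.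

Let nu_semi_sigma_additive : semi_sigma_additive nu.
Proof.
move=> F mF tF mUF; rewrite /nu preimage_bigcup.
rewrite ge0_integral_bigcup//=; first 1 last.
- by move=> n; exact: mfA.
- by move=> x _; rewrite lee_fin.
- apply/trivIsetP => /= i j _ _ ij; rewrite -preimage_setI.
  by move/trivIsetP : tF => /(_ _ _ _ _ ij) ->//; rewrite preimage_set0.
by apply: is_cvg_ereal_nneg_natsum_cond => n _ _; exact: nu_ge0.
Qed.

Definition wpush : {measure set S -> \bar R} :=
  HB.pack nu (isMeasure.Build _ _ _ nu nu0 nu_ge0 nu_semi_sigma_additive).

Lemma wpushE A : wpush A = \int[mu]_(x in f @^-1` A) (g x)%:E.
Proof. by []. Qed.

Import HBNNSimple.

Lemma ge0_integral_wpush (F : S -> \bar R) :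
  measurable_fun setT F -> (forall y, 0 <= F y) ->
  \int[wpush]_y F y = \int[mu]_x ((g x)%:E * F (f x)).
Proof.
move=> mF F0.
have nnsfunE (h : {nnsfun S >-> R}) :
    \int[wpush]_y (h y)%:E = \int[mu]_x ((g x)%:E * (h (f x))%:E).
  under eq_integral do rewrite fimfunE -fsumEFin//.
  rewrite ge0_integral_fsum//; last 2 first.
  - by move=> y; exact/measurable_EFinP/measurable_funM.
  - by move=> y x _; rewrite nnfun_muleindic_ge0.
  transitivity (\sum_(k \in range h)
      \int[mu]_x (k%:E * ((g x)%:E * (\1_(f @^-1` (h @^-1` [set k])) x)%:E))).
    apply: eq_fsbigr => r /set_mem[s _ sr].
    have r0 : (0 <= r)%R by rewrite -sr.
    rewrite integralZl_indic_nnsfun// integral_indic// setIT.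
    rewrite ge0_integralZl//; last 2 first.
    - apply: emeasurable_funM; first exact: mgE.
      by apply/measurable_EFinP/measurable_indic/mfA.
    - by move=> x _; rewrite mule_ge0// lee_fin.
    congr (_ * _); rewrite wpushE integral_mkcond epatch_indic.
    by apply: eq_integral.
  rewrite -ge0_integral_fsum//; last 2 first.
  - move=> k; apply: measurable_funeM; apply: emeasurable_funM; first exact: mgE.
    by apply/measurable_EFinP/measurable_indic/mfA.
  - move=> k x _.
    (* A value [k] outside the range may be negative, but its level set is empty and the term
       vanishes. *)
    have [[y _ yk]|kh] := pselect (range h k).
      by rewrite -yk !mule_ge0// lee_fin.
    rewrite (_ : \1_ _ x = 0%R) ?mule0//.
    rewrite indicE memNset// => /= fxk; apply: kh.
    by exists (f x).
  apply: eq_integral => x _; rewrite [in RHS]fimfunE -fsumEFin// ge0_mule_fsumr.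
    by apply: eq_fsbigr => k _; rewrite muleCA EFinM.
  move=> k; exact: nnfun_muleindic_ge0.
pose h := nnsfun_approx measurableT mF.
transitivity (limn (fun n => \int[wpush]_y (h n y)%:E)).
  rewrite -monotone_convergence//.
  - apply: eq_integral => y _; apply/esym/cvg_lim => //.
    by apply: cvg_nnsfun_approx.
  - by move=> n; exact/measurable_EFinP/measurable_funP.
  - by move=> n y _; rewrite lee_fin.
  - by move=> y _ m n mn; rewrite lee_fin; exact/lefP/nd_nnsfun_approx.
under eq_fun do rewrite nnsfunE.
rewrite -monotone_convergence//.
- apply: eq_integral => x _; apply/cvg_lim => //.
  apply: cvgeZl => //.
  by apply: cvg_nnsfun_approx.
- move=> n; apply: emeasurable_funM; first exact: mgE.
  by apply/measurable_EFinP; exact: measurableT_comp.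
- by move=> n x _; rewrite mule_ge0// lee_fin.
- move=> x _ m n mn; rewrite lee_pmul// ?lee_fin//.
  exact/lefP/nd_nnsfun_approx.
Qed.

End weighted_pushforward.

(** * Translation invariance of Lebesgue measure *)

Section translation.
Context {R : realType}.
Local Notation mu := (@lebesgue_measure R).

Lemma lebesgue_measure_shift (a : R) (A : set R) : measurable A ->
  pushforward mu (fun x : measurableTypeR R => x + a : measurableTypeR R) A = mu A.
Proof.
have mshift : measurable_fun [set: measurableTypeR R]
    (fun x : measurableTypeR R => x + a : measurableTypeR R).
  exact: measurable_funD.
move=> mA; apply/esym/(@lebesgue_measure_unique R (pushforward mu
  (HB.pack (fun x : measurableTypeR R => x + a : measurableTypeR R)
  (isMeasurableFun.Build _ _ _ _ _ mshift) : {mfun _ >-> _}))) => //= _ [[b c]] _ <-.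
rewrite /pushforward.
have -> : (fun x : measurableTypeR R => x + a) @^-1` `]b, c]%classic =
    `]b - a, c - a]%classic.
  by apply/seteqP; split => x /=; rewrite !in_itv/= ltrBlDr lerBrDr.
by rewrite !lebesgue_measure_itv/= !lte_fin ltrD2r -!EFinB opprB addrA subrK.
Qed.

Lemma ge0_integral_shift (a : R) (f : R -> \bar R) :
  measurable_fun [set: R] f -> (forall x, 0 <= f x)%E ->
  (\int[mu]_x f (x + a)%R = \int[mu]_x f x)%E.
Proof.
move=> mf f0.
have mshift : measurable_fun [set: measurableTypeR R]
    (fun x : measurableTypeR R => x + a : measurableTypeR R).
  exact: measurable_funD.
have := @ge0_integral_pushforward _ _ _ _ R _ mshift mu setT f measurableT mf
  (fun x _ => f0 x).
rewrite preimage_setT => <-.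
apply: eq_measure_integral => A mA _.
exact: (lebesgue_measure_shift a mA).
Qed.

End translation.

(** * Iterated Lebesgue integrals over sequences *)

Definition coord_cylinder {R : realType} : set (set (nat -> R)) :=
  [set A | exists i (B : set R), measurable B /\ A = (fun x => x i) @^-1` B].

(** Infinite sequences give all grid sizes the same type; an integral over [n] variables acts on the
    first [n] slots and leaves the others as parameters. *)
Definition rseq (R : realType) := g_sigma_algebraType (@coord_cylinder R).

Definition upd {R : realType} (k : nat) (x : rseq R) (y : R) : rseq R :=
  fun i => if i == k then y else x i.

Section rseq_measurable.
Context {R : realType}.

Lemma measurable_coord i : measurable_fun [set: rseq R] (fun x : rseq R => x i).
Proof.
move=> _ B mB; rewrite setTI; apply: sub_sigma_algebra.
by exists i, B.
Qed.

Lemma measurable_rseqP d (T : measurableType d) (f : T -> rseq R) :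
  (forall i, measurable_fun [set: T] (fun x => f x i)) ->
  measurable_fun [set: T] f.
Proof.
move=> mf; apply: (@measurability _ _ T (rseq R) setT f (@coord_cylinder R)) => //.
move=> _ [_ [i [B [mB ->]]]] <-.
by have := mf i measurableT B mB.
Qed.

Lemma measurable_upd d (T : measurableType d) k (f : T -> rseq R) (g : T -> R) :
  measurable_fun [set: T] f -> measurable_fun [set: T] g ->
  measurable_fun [set: T] (fun x => upd k (f x) (g x)).
Proof.
move=> mf mg; apply: measurable_rseqP => i.
rewrite /upd; case: eqP => // _.
exact: (measurableT_comp (measurable_coord i)).
Qed.

Lemma upd_id k (x : rseq R) : upd k x (x k) = x.
Proof. by apply/funext => i; rewrite /upd; case: eqP => // ->. Qed.

Lemma upd_upd k (x : rseq R) y z : upd k (upd k x y) z = upd k x z.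
Proof. by apply/funext => i; rewrite /upd; case: eqP. Qed.

Lemma updC k j (x : rseq R) y z : k != j ->
  upd k (upd j x z) y = upd j (upd k x y) z.
Proof.
move=> kj; apply/funext => i; rewrite /upd; case: eqP => // ->.
by rewrite (negbTE kj).
Qed.

Lemma upd_eq k (x : rseq R) y : upd k x y k = y.
Proof. by rewrite /upd eqxx. Qed.

Lemma upd_neq k i (x : rseq R) y : i != k -> upd k x y i = x i.
Proof. by rewrite /upd => /negbTE ->. Qed.

End rseq_measurable.

Definition coord_integral {R : realType} (k : nat) (G : rseq R -> \bar R) :
  rseq R -> \bar R := fun x => (\int[lebesgue_measure]_y G (upd k x y))%E.

(** Iterating one-variable integrals, rather than integrating over a product space, reduces
    invariance under a shear to a translation in a single variable. *)
Fixpoint iter_integral {R : realType} (n : nat) (G : rseq R -> \bar R) :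
  rseq R -> \bar R :=
  if n is m.+1 then iter_integral m (coord_integral m G) else G.

(** When [h] ignores slot [k], this is a change of variables of Jacobian 1: a translation of slot
    [k] once the other slots are fixed. *)
Definition shear {R : realType} (k : nat) (h : rseq R -> R) (x : rseq R) :
  rseq R := upd k x (x k + h x).

Fixpoint shears {R : realType} (h : nat -> rseq R -> R) (m : nat)
    (x : rseq R) : rseq R :=
  if m is k.+1 then shear k (h k) (shears h k x) else x.

Fixpoint unshears {R : realType} (h : nat -> rseq R -> R) (m : nat)
    (x : rseq R) : rseq R :=
  if m is k.+1 then unshears h k (shear k (fun x => - h k x) x) else x.

Section iterated_integral.
Context {R : realType}.
Implicit Types (G : rseq R -> \bar R).

Lemma measurable_coord_integral k G : measurable_fun setT G ->
  (forall x, 0 <= G x)%E -> measurable_fun setT (coord_integral k G).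
Proof.
move=> mG G0.
apply: (@measurable_fun_fubini_tonelli_F _ _ _ _ _ (@lebesgue_measure R)
  (fun p : rseq R * R => G (upd k p.1 p.2))) => //.
apply: (measurableT_comp mG).
exact: measurable_upd.
Qed.

Lemma coord_integral_ge0 k G : (forall x, 0 <= G x)%E ->
  (forall x, 0 <= coord_integral k G x)%E.
Proof. by move=> G0 x; apply: integral_ge0 => y _. Qed.

Lemma coord_integralC j k G : j != k -> measurable_fun setT G ->
  (forall x, 0 <= G x)%E ->
  coord_integral j (coord_integral k G) = coord_integral k (coord_integral j G).
Proof.
move=> jk mG G0; apply/funext => x; rewrite /coord_integral.
pose f (p : R * R) := G (upd k (upd j x p.1) p.2).
have mf : measurable_fun setT f.
  apply: (measurableT_comp mG).
  by apply: measurable_upd; [exact: measurable_upd|exact: measurable_snd].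
have := fubini_tonelli (m1 := @lebesgue_measure R) (m2 := @lebesgue_measure R)
  f mf (fun=> G0 _).
rewrite /f/= => ->.
by apply: eq_integral => y _; apply: eq_integral => y0 _; rewrite updC// eq_sym.
Qed.

(** By Tonelli the integral over slot [k] can be exchanged with those over higher slots until it is
    performed first. *)
Lemma eq_iter_integral k n G1 G2 : (k < n)%N ->
  measurable_fun setT G1 -> (forall x, 0 <= G1 x)%E ->
  measurable_fun setT G2 -> (forall x, 0 <= G2 x)%E ->
  coord_integral k G1 = coord_integral k G2 ->
  iter_integral n G1 = iter_integral n G2.
Proof.
elim: n G1 G2 => // n IH G1 G2; rewrite ltnS leq_eqVlt => /orP[/eqP ->|kn].
  by move=> _ _ _ _ /= ->.
move=> mG1 G10 mG2 G20 G12; have kn' : k != n by rewrite ltn_eqF.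
rewrite /=; apply: IH; [exact: kn|exact: measurable_coord_integral
  |exact: coord_integral_ge0|exact: measurable_coord_integral
  |exact: coord_integral_ge0|].
by rewrite (coord_integralC kn' mG1 G10) (coord_integralC kn' mG2 G20) G12.
Qed.

Lemma measurable_shear k (h : rseq R -> R) : measurable_fun setT h ->
  measurable_fun setT (shear k h).
Proof.
move=> mh; apply: measurable_upd => //; apply: measurable_funD => //.
exact: measurable_coord.
Qed.

Lemma shearK k (h : rseq R -> R) : (forall x y, h (upd k x y) = h x) ->
  cancel (shear k h) (shear k (fun x => - h x)).
Proof.
by move=> hk x; rewrite /shear hk upd_upd upd_eq addrK upd_id.
Qed.

Lemma iter_integral_shear k n (h : rseq R -> R) G : (k < n)%N ->
  measurable_fun setT h -> (forall x y, h (upd k x y) = h x) ->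
  measurable_fun setT G -> (forall x, 0 <= G x)%E ->
  iter_integral n (G \o shear k h) = iter_integral n G.
Proof.
move=> kn mh hk mG G0; apply: (@eq_iter_integral k) => //.
- by apply: (measurableT_comp mG); exact: measurable_shear.
- by move=> x /=.
- apply/funext => x; rewrite /coord_integral /=.
  under eq_integral do rewrite /shear hk upd_upd upd_eq.
  rewrite (@ge0_integral_shift _ (h x) (fun y => G (upd k x y)))//.
  by apply: (measurableT_comp mG); exact: measurable_upd.
Qed.

Section shears.
Variable h : nat -> rseq R -> R.
Hypotheses (mh : forall k, measurable_fun setT (h k)).
Hypothesis hupd : forall k x y, h k (upd k x y) = h k x.

Lemma shearsK m : cancel (shears h m) (unshears h m).
Proof. by elim: m => [//|m IH] x /=; rewrite shearK. Qed.

Lemma measurable_shears m : measurable_fun setT (shears h m).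
Proof.
elim: m => [|m IH] /=; first exact: measurable_id.
by apply: (measurableT_comp _ IH); exact: measurable_shear.
Qed.

Lemma measurable_unshears m : measurable_fun setT (unshears h m).
Proof.
elim: m => [|m IH] /=; first exact: measurable_id.
apply: (measurableT_comp IH); apply: measurable_shear.
exact: measurable_funN.
Qed.

Lemma iter_integral_shears m n G : (m <= n)%N ->
  measurable_fun setT G -> (forall x, 0 <= G x)%E ->
  iter_integral n (G \o shears h m) = iter_integral n G.
Proof.
elim: m G => [//|m IH] G mn mG G0.
have mS := measurable_shear m (mh m).
rewrite -[LHS]/(iter_integral n ((G \o shear m (h m)) \o shears h m)).
rewrite IH; [|exact: ltnW|exact: (measurableT_comp mG mS)|by move=> x; exact: G0].
by apply: iter_integral_shear => //; exact: hupd.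
Qed.

End shears.

End iterated_integral.

(** * The discrete transformation *)

(* A sequence [y] encodes a path on a grid of mesh [dt] started at 0: slot [i]
   holds the value at time [(i + 1) dt]. *)
Definition gpath {R : realType} (y : rseq R) (i : nat) : R :=
  if i is j.+1 then y j else 0.

(* The sum of the two adjacent values in the exponent, instead of twice the left
   one, is what makes [gZ] exactly invariant under [gT]. *)
Definition gA {R : realType} (dt : R) (y : rseq R) (i : nat) : R :=
  \sum_(j < i) dt * expR (gpath y j + gpath y j.+1).

Definition gZ {R : realType} (dt : R) (y : rseq R) (i : nat) : R :=
  expR (- gpath y i) * gA dt y i.

Definition gT {R : realType} (dt : R) (n : nat) (z : R) (y : rseq R) : rseq R :=
  fun i => if (i < n)%N
           then y i - ln (1 + gA dt y i.+1 / gA dt y n * (expR z - 1))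
           else y i.

Section discrete_transform.
Context {R : realType} (dt : R) (n : nat).
Hypotheses (dt0 : 0 < dt) (n0 : (0 < n)%N).
Implicit Types (y : rseq R) (z : R).

Lemma gAS y i : gA dt y i.+1 = gA dt y i + dt * expR (gpath y i + gpath y i.+1).
Proof. by rewrite /gA big_ord_recr. Qed.

Lemma gA_ge0 y i : 0 <= gA dt y i.
Proof. by apply: sumr_ge0 => j _; rewrite mulr_ge0 ?expR_ge0// ltW. Qed.

Lemma gA_gt0 y i : (0 < i)%N -> 0 < gA dt y i.
Proof.
case: i => // i _; rewrite gAS ltr_wpDl ?gA_ge0//.
by rewrite mulr_gt0 ?expR_gt0.
Qed.

Lemma gA_le y i j : (i <= j)%N -> gA dt y i <= gA dt y j.
Proof.
elim: j => [|j IH]; first by rewrite leqn0 => /eqP ->.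
rewrite leq_eqVlt => /orP[/eqP -> //|]; rewrite ltnS => /IH.
move=> /le_trans; apply; rewrite gAS lerDl mulr_ge0 ?expR_ge0//.
exact: ltW.
Qed.

(** The factor by which the transformation divides [exp phi_i]. It is affine in [gA] and runs from 1
    at the start to [exp z] at the end, hence the lower bound by their minimum. *)
Definition gw z y i := 1 + gA dt y i / gA dt y n * (expR z - 1).

Lemma gw_ge z y i : (i <= n)%N -> Num.min 1 (expR z) <= gw z y i.
Proof.
move=> im; have An := gA_gt0 y n0.
set r := gA dt y i / gA dt y n.
have r0 : 0 <= r by rewrite divr_ge0 ?gA_ge0.
have r1 : r <= 1 by rewrite ler_pdivrMr// mul1r gA_le.
rewrite /gw -/r; have -> : 1 + r * (expR z - 1) = (1 - r) * 1 + r * expR z by ring.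
set k := Num.min _ _.
have k1 : k <= 1 by rewrite ge_min lexx.
have kz : k <= expR z by rewrite ge_min lexx orbT.
have -> : k = (1 - r) * k + r * k by ring.
by rewrite lerD// ler_wpM2l// subr_ge0.
Qed.

Lemma gw_gt0 z y i : (i <= n)%N -> 0 < gw z y i.
Proof.
by move=> im; rewrite (lt_le_trans _ (gw_ge z y im))// lt_min ltr01 expR_gt0.
Qed.

Lemma gwn z y : gw z y n = expR z.
Proof. by rewrite /gw divff ?gt_eqF ?gA_gt0// mul1r addrC subrK. Qed.

Lemma gpath_gT z y i : (i <= n)%N ->
  gpath (gT dt n z y) i = gpath y i - ln (gw z y i).
Proof.
case: i => [|i] im; first by rewrite /gw /gA big_ord0 !mul0r addr0 ln1 subr0.
by rewrite /= /gT im.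
Qed.

Lemma expR_gpath_gT z y i : (i <= n)%N ->
  expR (gpath (gT dt n z y) i) = expR (gpath y i) / gw z y i.
Proof. by move=> im; rewrite gpath_gT// expRB lnK// posrE gw_gt0. Qed.

Lemma gwS z y i : gw z y i.+1 = gw z y i +
  (expR z - 1) / gA dt y n * dt * expR (gpath y i) * expR (gpath y i.+1).
Proof. by rewrite /gw gAS expRD; ring. Qed.

(** The transformed increment is [dt * p * q / (w_i * w_(i+1))], and [w] is affine in [gA]; this is
    the discrete form of the derivative of [A / (1 + c * A)]. *)
Lemma gA_gT z y i : (i <= n)%N ->
  gA dt (gT dt n z y) i = gA dt y i / gw z y i.
Proof.
elim: i => [|i IH] im; first by rewrite /gA !big_ord0 mul0r.
have i0 := gw_gt0 z y (ltnW im).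
have i1 := gw_gt0 z y im.
have An := gA_gt0 y n0.
rewrite gAS IH; last exact: ltnW.
rewrite expRD !expR_gpath_gT//; last exact: ltnW.
rewrite gAS expRD; move: i1; rewrite gwS.
have : gw z y i = 1 + gA dt y i * ((expR z - 1) / gA dt y n).
  by rewrite /gw mulrAC mulrA.
set a := gA dt y i; set p := expR (gpath y i); set q := expR (gpath y i.+1).
set c := (expR z - 1) / _; move: i0; set w := gw z y i => w0 wE w'0.
transitivity ((a * (w + c * dt * p * q) + dt * p * q) /
              (w * (w + c * dt * p * q))).
  by field; rewrite !gt_eqF.
transitivity (((a + dt * p * q) * w) / (w * (w + c * dt * p * q))).
  by congr (_ / _); rewrite wE; ring.
by field; rewrite !gt_eqF.
Qed.

Lemma gZ_gT z y i : (i <= n)%N -> gZ dt (gT dt n z y) i = gZ dt y i.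
Proof.
move=> im; rewrite /gZ gA_gT// !expRN expR_gpath_gT//.
have := gw_gt0 z y im; have := expR_gt0 (gpath y i).
by move=> ? ?; field; rewrite !gt_eqF.
Qed.

Lemma gpath_gTn z y : gpath (gT dt n z y) n = gpath y n - z.
Proof. by rewrite gpath_gT// gwn expRK. Qed.

Lemma gTK z : cancel (gT dt n z) (gT dt n (- z)).
Proof.
move=> y; apply/funext => i; rewrite {1}/gT; case: ifPn => im; last first.
  by rewrite /gT (negbTE im).
have := gpath_gT z y im; rewrite [LHS]/= => ->.
rewrite !gA_gT// gwn.
have An := gA_gt0 y n0; have w0 := gw_gt0 z y im; have z0 := expR_gt0 z.
(* The factor that [gT (- z)] builds from the transformed path is the inverse of the original one,
   so the two logarithms cancel. *)
rewrite (_ : 1 + _ = (gw z y i.+1)^-1).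
  by rewrite lnV ?posrE// opprK subrK.
have wE : gw z y i.+1 - gA dt y i.+1 / gA dt y n * (expR z - 1) = 1.
  by rewrite /gw addrK.
rewrite expRN -[RHS]mul1r -[in RHS]wE; move: w0 {wE}.
set w := gw z y _ => w0.
by field; rewrite !gt_eqF.
Qed.

Lemma gT_energy z y :
  \sum_(i < n) cosh (gpath (gT dt n z y) i.+1 - gpath (gT dt n z y) i) / dt =
  \sum_(i < n) cosh (gpath y i.+1 - gpath y i) / dt +
    (cosh (gpath y n - z) - cosh (gpath y n)) / gZ dt y n.
Proof.
pose c := (expR z - 1) / gA dt y n.
(* Let [p], [q] be the exponentials of the two end values. The transformation changes [exp] of the
   increment by [- c * dt * q^2 / w_(i+1)] and [exp] of its opposite by [c * dt * p^2 / w_i], so [g]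
   is an exact primitive of the difference of energies. *)
pose g i := - (c / 2) * expR (gpath y i) ^+ 2 / gw z y i.
apply/eqP; rewrite addrC -subr_eq -sumrB; apply/eqP.
transitivity (\sum_(i < n) (g i.+1 - g i)).
  apply: eq_bigr => i _; have im : (i < n)%N by [].
  rewrite /cosh !opprB !expRB !expR_gpath_gT//; last exact: ltnW.
  rewrite /g; have := gw_gt0 z y im; have := gw_gt0 z y (ltnW im).
  rewrite gwS -/c; have := expR_gt0 (gpath y i); have := expR_gt0 (gpath y i.+1).
  set p := expR _; set q := expR _; set w := gw _ _ _.
  by move=> *; field; rewrite !gt_eqF.
rewrite -(big_mkord xpredT (fun i => g i.+1 - g i)) telescope_sumr// /g gwn.
have -> : gw z y 0 = 1 by rewrite /gw /gA big_ord0 !mul0r addr0.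
rewrite /gZ /cosh /= !expRN !expRB expR0 /c.
have := gA_gt0 y n0; have := expR_gt0 z; have := expR_gt0 (gpath y n).
set p := expR _; set q := expR _; set w := gA _ _ _.
by move=> *; field; rewrite !gt_eqF.
Qed.

End discrete_transform.

(* [Z_(i+2) = exp phi_(i+1) * (Z_(i+1) * exp (- phi_(i+2)) + dt)]: once slot [i-1]
   holds [ln Z_(i+1)], replacing [phi_(i+1)] by [ln Z_(i+2)] is a translation of
   slot [i] by a function of the neighbouring slots. *)
Definition logZ_shift {R : realType} (dt : R) (i : nat) (x : rseq R) : R :=
  ln (dt + expR ((if i is j.+1 then x j else ln dt) - x i.+1)).

Section lebesgue_invariance.
Context {R : realType} (dt : R).
Hypotheses (dt0 : 0 < dt).
Implicit Types (y : rseq R) (z : R).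

Lemma measurable_gpath i : measurable_fun [set: rseq R] (fun y => gpath y i).
Proof. by case: i => [|i] //=; exact: measurable_coord. Qed.

Lemma measurable_gA i : measurable_fun [set: rseq R] (fun y => gA dt y i).
Proof.
apply: measurable_sum => j; apply: measurable_funM => //.
apply: measurableT_comp => //.
by apply: measurable_funD; exact: measurable_gpath.
Qed.

Lemma measurable_funVr d (T : measurableType d) (f : T -> R) :
  (forall x, 0 < f x) ->
  measurable_fun setT f -> measurable_fun setT (fun x => (f x)^-1).
Proof.
move=> f0 mf; have -> : (fun x => (f x)^-1) = (fun x => expR (- ln (f x))).
  by apply/funext => x; rewrite expRN lnK// posrE.
apply: measurableT_comp => //; apply: measurable_funN.
exact: measurableT_comp.
Qed.

Lemma measurable_gZ i : measurable_fun [set: rseq R] (fun y => gZ dt y i).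
Proof.
apply: measurable_funM; last exact: measurable_gA.
apply: measurableT_comp => //; apply: measurable_funN.
exact: measurable_gpath.
Qed.

Lemma measurable_gT n z : measurable_fun [set: rseq R] (gT dt n z).
Proof.
apply: measurable_rseqP => i; rewrite /gT.
have [im|_] := boolP (i < n)%N; last first.
  exact: measurable_coord.
apply: measurable_funB; first exact: measurable_coord.
apply: measurableT_comp => //; apply: measurable_funD => //.
apply: measurable_funM => //; apply: measurable_funM.
  exact: measurable_gA.
apply: measurable_funVr; last exact: measurable_gA.
by move=> y; apply: gA_gt0 => //; exact: leq_ltn_trans im.
Qed.

Lemma measurable_logZ_shift i : measurable_fun setT (@logZ_shift R dt i).
Proof.
apply: measurableT_comp => //; apply: measurable_funD => //.
apply: measurableT_comp => //; apply: measurable_funB.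
  by case: i => [|i] //; exact: measurable_coord.
exact: measurable_coord.
Qed.

Lemma logZ_shift_upd i (x : rseq R) (u : R) :
  logZ_shift dt i (upd i x u) = logZ_shift dt i x.
Proof.
rewrite /logZ_shift upd_neq ?gtn_eqF//.
by case: i => // i; rewrite upd_neq// ltn_eqF.
Qed.

Lemma shears_logZE m y i :
  shears (logZ_shift dt) m y i = if (i < m)%N then ln (gZ dt y i.+2) else y i.
Proof.
elim: m i => [//|m IH] i /=; rewrite /shear.
have [->|im] := eqVneq i m; last first.
  by rewrite upd_neq// IH ltnS [in RHS]leq_eqVlt (negbTE im).
rewrite upd_eq ltnSn /logZ_shift !IH ltnn ltnNge leqnSn /=.
have -> : expR ((if m is j.+1 then shears (logZ_shift dt) m y j else ln dt) - y m.+1) =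
    gZ dt y m.+1 * expR (- y m.+1).
  rewrite expRD; congr (_ * _).
  (* For slot 0 the preceding value is [Z_1 = dt], which is why [logZ_shift] starts from [ln dt]. *)
  case: m IH => [|m] IH.
    rewrite lnK ?posrE// /gZ /gA big_ord1 /= add0r expRN.
    by rewrite mulrCA mulVf ?mulr1// gt_eqF ?expR_gt0.
  rewrite IH ltnSn lnK// posrE /gZ mulr_gt0 ?expR_gt0//.
  exact: gA_gt0.
have Z0 : 0 < gZ dt y m.+1 by rewrite mulr_gt0 ?expR_gt0 ?gA_gt0.
rewrite -[X in X + _]expRK -lnM ?posrE ?expR_gt0//; last first.
  by rewrite addr_gt0// mulr_gt0// expR_gt0.
congr ln; rewrite /gZ (gAS _ _ m.+1) /= expRD.
have := expR_gt0 (y m); have := expR_gt0 (y m.+1); rewrite !expRN.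
by move=> *; field; rewrite !gt_eqF.
Qed.

Lemma gT_shear n z y :
  gT dt n.+1 z y = unshears (logZ_shift dt) n
    (shear n (cst (- z)) (shears (logZ_shift dt) n y)).
Proof.
rewrite -[LHS](shearsK logZ_shift_upd n); congr unshears; apply/funext => i.
rewrite /shear /upd !shears_logZE ltnn; case: eqP => [->|/eqP inn].
  by rewrite ltnn; have := gpath_gTn dt0 (ltn0Sn n) z y.
case: ifPn => im; first by rewrite gZ_gT// ltnS.
by rewrite /gT ltnS leq_eqVlt (negbTE im) (negbTE inn).
Qed.

Lemma iter_integral_gT n z (G : rseq R -> \bar R) :
  measurable_fun setT G -> (forall x, 0 <= G x)%E ->
  iter_integral n.+1 (G \o gT dt n.+1 z) = iter_integral n.+1 G.
Proof.
move=> mG G0; pose h := @logZ_shift R dt.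
have mGZ := measurableT_comp mG (measurable_unshears measurable_logZ_shift n).
have mS : measurable_fun setT (@shear R n (cst (- z))) by exact: measurable_shear.
transitivity (iter_integral n.+1
    (((G \o unshears h n) \o shear n (cst (- z))) \o shears h n)).
  by congr iter_integral; apply/funext => y /=; rewrite gT_shear.
rewrite (iter_integral_shears measurable_logZ_shift logZ_shift_upd (leqnSn n)
  (measurableT_comp mGZ mS)); last by move=> x; exact: G0.
rewrite iter_integral_shear//; last by move=> x; exact: G0.
rewrite -(iter_integral_shears measurable_logZ_shift logZ_shift_upd
  (leqnSn n) mGZ); last by move=> x; exact: G0.
congr iter_integral; apply/funext => x /=.
by rewrite (shearsK logZ_shift_upd).
Qed.

End lebesgue_invariance.

(** * Brownian motion on a grid *)

Section rectangles.
Context {R : realType}.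

Definition rectangle : set (set (rseq R)) :=
  [set E | exists2 A : nat -> set R, (forall i, measurable (A i)) &
     E = [set x : rseq R | forall i, A i (x i)]].

Lemma rectangle_setI : setI_closed rectangle.
Proof.
move=> _ _ [A mA ->] [B mB ->]; exists (fun i => A i `&` B i).
  by move=> i; exact: measurableI.
apply/seteqP; split => x /=; first by move=> [Ax Bx] i.
by move=> AB; split => i; have [] := AB i.
Qed.

Lemma measurable_rectangle : rectangle `<=` @measurable _ (rseq R).
Proof.
move=> _ [A mA ->].
rewrite (_ : [set _ | _] = \bigcap_i ((fun x : rseq R => x i) @^-1` A i)).
  apply: bigcap_measurable; first by exists 0%N.
  move=> i _; rewrite -[X in measurable X]setTI.
  exact: measurable_coord.
by apply/seteqP; split => x /=; [move=> Ax i _|move=> Ax i]; exact: Ax.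
Qed.

Lemma rseq_measurable_rectangle (E : set (rseq R)) :
  measurable E -> <<s rectangle >> E.
Proof.
apply: smallest_sub; first exact: smallest_sigma_algebra.
move=> _ [i [B [mB ->]]]; apply: sub_sigma_algebra.
exists (fun j => if j == i then B else setT).
  by move=> j; case: ifP.
apply/seteqP; split => x /=; last by move/(_ i); rewrite eqxx.
by move=> Bx j; case: eqP => // ->.
Qed.

Lemma rseq_measure_unique (m1 m2 : {measure set (rseq R) -> \bar R}) :
  (m1 setT < +oo)%E -> (forall E, rectangle E -> m1 E = m2 E) ->
  forall E, measurable E -> m1 E = m2 E.
Proof.
move=> m1oo m12 E /rseq_measurable_rectangle.
apply: (g_sigma_algebra_measure_unique rectangle measurable_rectangle
  (fun=> setT)) => //.
- move=> _; exists (fun=> setT) => //.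
  by apply/seteqP; split.
- by rewrite bigcup_const//; exists 0%N.
- exact: rectangle_setI.
Qed.

End rectangles.

Section grid_increments.
Context d (T : measurableType d) (R : realType) (P : probability T R).
Variables (B : brownian_motion P) (dt : R).
Hypothesis dt0 : 0 < dt.
Local Notation sd := (Num.sqrt dt).

Definition binc (i : nat) (w : T) : R := B (i.+1%:R * dt) w - B (i%:R * dt) w.

(** The zeros beyond slot [k] make passing from [k] to [k.+1] an update of a single slot. *)
Definition incs (k : nat) (w : T) : rseq R :=
  fun i => if (i < k)%N then binc i w else 0.

Lemma measurable_bm_grid i : measurable_fun setT (B (i%:R * dt)).
Proof. by apply: bm_measurable; rewrite mulr_ge0// ltW. Qed.

Lemma measurable_binc i : measurable_fun setT (binc i).
Proof. by apply: measurable_funB; exact: measurable_bm_grid. Qed.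

Lemma measurable_incs k : measurable_fun setT (incs k).
Proof.
apply: measurable_rseqP => i; rewrite /incs.
by case: (i < k)%N => //; exact: measurable_binc.
Qed.

Lemma binc_law i (A : set R) : measurable A ->
  P (binc i @^-1` A) = normal_prob 0 sd A.
Proof.
move=> mA.
have e : i.+1%:R * dt - i%:R * dt = dt :> R by rewrite -mulrBl -natrB// subSnn mul1r.
have i0 : 0 <= i%:R * dt by rewrite mulr_ge0// ltW.
have ii : i%:R * dt < i.+1%:R * dt by rewrite ltr_pM2r// ltr_nat.
by have := bm_gaussian B i0 ii mA; rewrite e.
Qed.

Lemma binc_independent k (A : nat -> set R) : (forall i, measurable (A i)) ->
  P [set w | forall i, (i < k)%N -> A i (binc i w)] =
  (\prod_(i < k) P (binc i @^-1` A i))%E.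
Proof.
move=> mA.
have := bm_independent B (n := k) (s := fun i => i%:R * dt).
rewrite mul0r => /(_ (lexx _)) ind.
have sle i : (i < k)%N -> (i%:R * dt <= i.+1%:R * dt :> R).
  by move=> _; rewrite ler_pM2r// ler_nat.
have := ind sle [set: 'I_k]%SET (fun i => A i) (fun i => mA i).
rewrite (_ : \bigcap_(i in _) _ =
    [set w | forall i, (i < k)%N -> A i (binc i w)]).
  by move=> ->; apply: eq_bigl => i; rewrite inE.
apply/seteqP; split => w /= h.
  by move=> i ik; apply: (h (Ordinal ik)); rewrite /= inE.
by move=> i _; exact: h.
Qed.

(** For fixed [C] both sides are finite measures in [E]. Independence of the increments gives their
    equality on rectangles, and uniqueness extends it to every measurable [E]. *)
Lemma incs_binc_independent k (E : set (rseq R)) (C : set R) :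
  measurable E -> measurable C ->
  P (incs k @^-1` E `&` binc k @^-1` C) =
  (P (incs k @^-1` E) * normal_prob 0%R sd C)%E.
Proof.
move=> mE mC.
have mbC : measurable (binc k @^-1` C).
  by rewrite -[X in measurable X]setTI; exact: measurable_binc.
have miE (F : set (rseq R)) : measurable F -> measurable (incs k @^-1` F).
  by move=> mF; rewrite -[X in measurable X]setTI; exact: measurable_incs.
have mind : measurable_fun setT (\1_(binc k @^-1` C) : T -> R).
  exact: measurable_indic.
have ind0 (x : T) : 0 <= (\1_(binc k @^-1` C) : T -> R) x by [].
have pC0 (x : T) : 0 <= cst (fine (normal_prob 0 sd C)) x.
  by rewrite fine_ge0.
pose m1 := wpush P (measurable_incs k) mind ind0.
pose m2 := wpush P (measurable_incs k) (measurable_cst _) pC0.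
have m1E F : measurable F -> m1 F = P (incs k @^-1` F `&` binc k @^-1` C).
  by move=> mF; rewrite /m1 wpushE integral_indic//; [rewrite setIC|exact: miE].
have m2E F : measurable F -> m2 F = (P (incs k @^-1` F) * normal_prob 0%R sd C)%E.
  move=> mF; rewrite /m2 wpushE.
  rewrite (integral_cst P (miE _ mF) (fine (normal_prob 0 sd C))%:E).
  by rewrite fineK ?fin_num_measure// muleC.
rewrite -m1E// -m2E//; apply: rseq_measure_unique => //.
  by rewrite m1E// (le_lt_trans (probability_le1 P _)) ?ltry//; apply: measurableI => //; exact: miE.
move=> F rF; have mF := measurable_rectangle rF.
rewrite m1E// m2E//; case: rF => A mA ->.
(* The slots from [k] on are constantly 0: either the rectangle excludes this value and has an empty
   preimage, or it constrains only the first [k] increments. *)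
have [A0|A0] := pselect (forall i, (k <= i)%N -> A i 0); last first.
  rewrite (_ : incs k @^-1` _ = set0) ?set0I ?measure0 ?mul0e//.
  rewrite -subset0 => w /= h; apply: A0 => i ki.
  by have := h i; rewrite /incs ltnNge ki.
have -> : incs k @^-1` [set x | forall i, A i (x i)] =
    [set w | forall i, (i < k)%N -> A i (binc i w)].
  apply/seteqP; split => w /= h.
    by move=> i ik; have := h i; rewrite /incs ik.
  by move=> i; rewrite /incs; case: ltnP => [|ki]; [exact: h|exact: A0].
rewrite binc_independent// -(binc_law k mC).
(* The set [C] becomes the constraint on increment [k], so that independence is applied to [k.+1]
   increments. *)
pose A' i := if (i < k)%N then A i else C.
rewrite (_ : _ `&` _ = [set w | forall i, (i < k.+1)%N -> A' i (binc i w)]).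
  rewrite binc_independent; last by move=> i; rewrite /A'; case: ifP.
  rewrite big_ord_recr /= {2}/A' ltnn; congr (_ * _)%E.
  by apply: eq_bigr => i _; rewrite /A' ltn_ord.
apply/seteqP; split => w /=.
  move=> [h Cw] i; rewrite ltnS leq_eqVlt => /orP[/eqP ->|ik].
    by rewrite /A' ltnn.
  by rewrite /A' ik; exact: h.
move=> h; split; last by have := h k (ltnSn k); rewrite /A' ltnn.
by move=> i ik; have := h i (ltnW ik); rewrite /A' ik.
Qed.

Lemma incsS k w : incs k.+1 w = upd k (incs k w) (binc k w).
Proof.
apply/funext => i; rewrite /incs /upd ltnS leq_eqVlt.
by case: eqP => [->|].
Qed.

Lemma ge0_integral_normal_prob (s : R) (f : R -> \bar R) :
  measurable_fun setT f -> (forall x, 0 <= f x)%E ->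
  (\int[normal_prob 0 s]_x f x =
   \int[lebesgue_measure]_x ((normal_pdf 0 s x)%:E * f x))%E.
Proof.
move=> mf f0.
rewrite -(ge0_integral_wpush lebesgue_measure (@measurable_id _ _ setT)
  (measurable_normal_pdf 0 s) (normal_pdf_ge0 0 s) mf f0).
by apply: eq_measure_integral => A mA _.
Qed.

Lemma integral_incsS k (G : rseq R -> \bar R) : measurable_fun setT G ->
  (forall x, 0 <= G x)%E ->
  (\int[P]_w G (incs k.+1 w) = \int[P]_w \int[lebesgue_measure]_y
     ((normal_pdf 0 sd y)%:E * G (upd k (incs k w) y)))%E.
Proof.
move=> mG G0.
pose X : {RV P >-> rseq R} :=
  HB.pack (incs k) (isMeasurableFun.Build _ _ _ _ _ (measurable_incs k)).
have mp : measurable_fun setT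
    (fun w => (incs k w, binc k w) : rseq R * measurableTypeR R).
  by apply: measurable_fun_pair; [exact: measurable_incs|exact: measurable_binc].
have c0 (x : T) : 0 <= cst (1 : R) x by [].
pose m := wpush P mp (measurable_cst _) c0.
pose f (p : rseq R * measurableTypeR R) := G (upd k p.1 p.2).
have mf : measurable_fun setT f.
  apply: (measurableT_comp mG).
  by apply: measurable_upd; [exact: measurable_fst|exact: measurable_snd].
have f0 p : (0 <= f p)%E by exact: G0.
transitivity (\int[m]_p f p)%E.
  rewrite (ge0_integral_wpush P mp (measurable_cst _) c0 mf f0).
  by apply: eq_integral => w _; rewrite mul1e /f /= incsS.
(* The joint law of the earlier increments and the next one is a product, so Tonelli splits off the
   last variable. *)
transitivity (\int[distribution P X \x normal_prob 0 sd]_p f p)%E.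
  apply: eq_measure_integral => D mD _.
  apply/esym; apply: product_measure_unique => // E C mE mC.
  have mEC : measurable ((fun w => (incs k w, binc k w)) @^-1` (E `*` C)).
    by have := mp measurableT _ (measurableX mE mC); rewrite setTI.
  rewrite /m wpushE (integral_cst P mEC 1%E) mul1e.
  exact: incs_binc_independent.
rewrite fubini_tonelli1//.
rewrite ge0_integral_distribution//; last 2 first.
- exact: measurable_fun_fubini_tonelli_F.
- by move=> y; apply: integral_ge0.
apply: eq_integral => w _ /=; rewrite /fubini_F.
rewrite ge0_integral_normal_prob//.
by apply: (measurableT_comp mf); exact: measurable_pair1.
Qed.

End grid_increments.

(** * The law of the grid values *)

Section grid_law.
Context d (T : measurableType d) (R : realType) (P : probability T R).
Variables (B : brownian_motion P) (dt : R).
Hypothesis dt0 : 0 < dt.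
Local Notation sd := (Num.sqrt dt).
Implicit Types (G : rseq R -> \bar R) (y : rseq R).

Let sd0 : sd != 0. Proof. by rewrite sqrtr_eq0 -ltNge. Qed.

Definition prod_pdf n (x : rseq R) : R := \prod_(i < n) normal_pdf 0 sd (x i).

Lemma prod_pdf_ge0 n x : 0 <= prod_pdf n x.
Proof. by apply: prodr_ge0 => i _; exact: normal_pdf_ge0. Qed.

Lemma integral_incs n G : measurable_fun setT G -> (forall x, 0 <= G x)%E ->
  (\int[P]_w G (incs B dt n w) =
   iter_integral n (fun x => G x * (prod_pdf n x)%:E) (fun=> 0%R))%E.
Proof.
elim: n G => [|n IH] G mG G0.
  rewrite /= /prod_pdf big_ord0 mule1.
  rewrite (_ : (fun w => _) = cst (G (fun=> 0%R))).
    by rewrite integral_cst//= probability_setT mule1.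
  by apply/funext => w; congr G.
rewrite integral_incsS// /=.
pose f (p : rseq R * measurableTypeR R) := ((normal_pdf 0%R sd p.2)%:E * G (upd n p.1 p.2))%E.
have mf : measurable_fun setT f.
  apply: emeasurable_funM.
    apply/measurable_EFinP.
    by apply: (measurableT_comp (measurable_normal_pdf 0 sd)).
  apply: (measurableT_comp mG).
  by apply: measurable_upd; [exact: measurable_fst|exact: measurable_snd].
have f0 p : (0 <= f p)%E by rewrite mule_ge0// lee_fin normal_pdf_ge0.
rewrite (IH (fun x => \int[lebesgue_measure]_y f (x, y))%E); last 2 first.
- exact: (measurable_fun_fubini_tonelli_F (m2 := @lebesgue_measure R) f mf f0).
- by move=> x; apply: integral_ge0.
congr (iter_integral n _ _); apply/funext => x; rewrite /coord_integral.
rewrite muleC -ge0_integralZl//; last 2 first.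
- by apply: (measurableT_comp mf); exact: (measurable_pair1 x).
- by rewrite lee_fin prod_pdf_ge0.
apply: eq_integral => y _; rewrite /f /= {2}/prod_pdf big_ord_recr/= upd_eq.
have -> : \prod_(i < n) normal_pdf 0 sd (upd n x y i) = prod_pdf n x.
  by apply: eq_bigr => i _; rewrite upd_neq// ltn_eqF.
by rewrite EFinM muleA muleC.
Qed.

(** Summing increments into positions is itself a succession of shears: slot [k] receives slot
    [k-1], which already holds a partial sum. *)
Definition cumul_shift (k : nat) (x : rseq R) : R := if k is j.+1 then x j else 0.

Lemma cumul_shift_upd k (x : rseq R) (u : R) :
  cumul_shift k (upd k x u) = cumul_shift k x.
Proof. by case: k => //= k; rewrite upd_neq// ltn_eqF. Qed.

Lemma measurable_cumul_shift k : measurable_fun setT (cumul_shift k).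
Proof. by case: k => [|k]; [exact: measurable_cst|exact: (measurable_coord k)]. Qed.

Lemma shears_cumulE m x i :
  shears cumul_shift m x i = if (i < m)%N then \sum_(j < i.+1) x j else x i.
Proof.
elim: m i => [//|m IH] i /=; rewrite /shear.
have [->|im] := eqVneq i m; last first.
  by rewrite upd_neq// IH ltnS [in RHS]leq_eqVlt (negbTE im).
rewrite upd_eq ltnSn IH ltnn big_ord_recr/= addrC; congr (_ + _).
case: m IH => [|m] IH; first by rewrite big_ord0.
by rewrite -[LHS]/(shears cumul_shift m.+1 x m) IH ltnSn.
Qed.

(** Subtracting [B 0] makes every sampled path start exactly at 0, as [gpath] presupposes, and not
    only almost surely. *)
Definition bm_grid n (w : T) : rseq R :=
  fun i => if (i < n)%N then B (i.+1%:R * dt) w - B 0 w else 0.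

Lemma bm_gridE n w : bm_grid n w = shears cumul_shift n (incs B dt n w).
Proof.
apply/funext => i; rewrite shears_cumulE /bm_grid; case: ltnP => [ni|ni]; last first.
  by rewrite /incs ltnNge ni.
rewrite (eq_bigr (fun j : 'I_i.+1 => binc B dt j w)); last first.
  by move=> j _; rewrite /incs (leq_trans _ ni).
rewrite -(big_mkord xpredT (fun j => binc B dt j w)).
by rewrite (telescope_sumr (fun j => B (j%:R * dt) w))// mul0r.
Qed.

Definition grid_pdf n (y : rseq R) : R :=
  \prod_(i < n) normal_pdf 0 sd (gpath y i.+1 - gpath y i).

Lemma measurable_grid_pdf n : measurable_fun setT (grid_pdf n).
Proof.
apply: measurable_prod => i _.
apply: (measurableT_comp (measurable_normal_pdf 0 sd)).
by apply: measurable_funB; exact: measurable_gpath.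
Qed.

Lemma grid_pdf_gt0 n y : 0 < grid_pdf n y.
Proof.
apply: prodr_gt0 => i _; rewrite normal_pdfE// mulr_gt0 ?expR_gt0//.
exact: normal_peak_gt0.
Qed.

Lemma grid_pdf_cumul n x : grid_pdf n (shears cumul_shift n x) = prod_pdf n x.
Proof.
apply: eq_bigr => -[i ni] _ /=; rewrite shears_cumulE ni; congr normal_pdf.
case: i ni => [|i] ni /=; first by rewrite big_ord1 subr0.
by rewrite shears_cumulE (ltnW ni) big_ord_recr/= addrAC subrr add0r.
Qed.

Lemma integral_bm_grid n G : measurable_fun setT G -> (forall x, 0 <= G x)%E ->
  (\int[P]_w G (bm_grid n w) =
   iter_integral n (fun y => G y * (grid_pdf n y)%:E) (fun=> 0%R))%E.
Proof.
move=> mG G0.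
have mc := measurable_shears measurable_cumul_shift n.
under eq_integral do rewrite bm_gridE.
rewrite (@integral_incs n (G \o shears cumul_shift n)); last 2 first.
- exact: (measurableT_comp mG mc).
- by move=> x; exact: G0.
rewrite -[in RHS](iter_integral_shears measurable_cumul_shift cumul_shift_upd (leqnn n)).
- congr (iter_integral n _ _); apply/funext => x /=.
  by rewrite grid_pdf_cumul.
- apply: emeasurable_funM => //; apply/measurable_EFinP.
  exact: measurable_grid_pdf.
- by move=> x; rewrite mule_ge0// lee_fin ltW// grid_pdf_gt0.
Qed.

(** The inverse map [gT (- z)] occurs because the substitution that removes [gT z] from the
    functional puts its inverse into the grid density. *)
Definition log_ratio n z y : R := \sum_(i < n)
  ((gpath y i.+1 - gpath y i) ^+ 2 -
   (gpath (gT dt n (- z) y) i.+1 - gpath (gT dt n (- z) y) i) ^+ 2) / (2 * dt).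

Lemma log_ratioE n z y :
  grid_pdf n (gT dt n (- z) y) = grid_pdf n y * expR (log_ratio n z y).
Proof.
rewrite /log_ratio /grid_pdf expR_sum -big_split /=; apply: eq_bigr => i _.
rewrite normal_pdfE// /normal_fun -!mulrA -expRD !subr0 sqr_sqrtr; last exact: ltW.
congr (_ * expR _); rewrite -mulr_natl.
by field; rewrite gt_eqF.
Qed.

Lemma measurable_log_ratio n z : measurable_fun setT (log_ratio n z).
Proof.
apply: measurable_sum => i; apply: measurable_funM => //.
have mg j : measurable_fun [set: rseq R] (fun y => gpath (gT dt n (- z) y) j).
  apply: (measurableT_comp (measurable_gpath j)); exact: measurable_gT.
apply: measurable_funB; apply: measurable_funX; apply: measurable_funB => //;
  exact: measurable_gpath.
Qed.

Lemma integral_gT_bm_grid n z G :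
  measurable_fun setT G -> (forall x, 0 <= G x)%E ->
  (\int[P]_w G (gT dt n.+1 z (bm_grid n.+1 w)) = \int[P]_w
     (G (bm_grid n.+1 w) * (expR (log_ratio n.+1 z (bm_grid n.+1 w)))%:E))%E.
Proof.
move=> mG G0; have mT := measurable_gT dt0 n.+1 z.
have mL : measurable_fun setT (fun y => (expR (log_ratio n.+1 z y))%:E).
  apply/measurable_EFinP; apply: measurableT_comp => //.
  exact: measurable_log_ratio.
rewrite (@integral_bm_grid n.+1 (G \o gT dt n.+1 z)); last 2 first.
- exact: (measurableT_comp mG mT).
- by move=> x; exact: G0.
rewrite (@integral_bm_grid n.+1
  (fun y => G y * (expR (log_ratio n.+1 z y))%:E)%E); last 2 first.
- exact: emeasurable_funM.
- by move=> x; rewrite mule_ge0// lee_fin expR_ge0.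
(* Substituting [gT z y] for [y] on the right turns the reweighted density, through [log_ratioE] and
   [gTK], back into the density at [y]. *)
rewrite -[in RHS](iter_integral_gT dt0 n z); last 2 first.
- apply: emeasurable_funM; first exact: emeasurable_funM.
  by apply/measurable_EFinP; exact: measurable_grid_pdf.
- by move=> x; rewrite !mule_ge0// lee_fin ?expR_ge0// ltW// grid_pdf_gt0.
congr (iter_integral n.+1 _ _); apply/funext => y /=.
by rewrite -muleA -EFinM [(expR _ * _)%R]mulrC -log_ratioE gTK.
Qed.

End grid_law.

(** * Lower bound for the discrete density *)

Section hyperbolic.
Context {R : realType}.
Implicit Types u v x : R.

Definition sinh x : R := (expR x - expR (- x)) / 2.

Lemma MVT_everywhere (f df : R -> R) (a b : R) :
  (forall x, is_derive x 1 f (df x)) -> a <= b ->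
  exists2 c, a <= c <= b & f b - f a = df c * (b - a).
Proof.
move=> fdf ab.
have cf : {within `[a, b], continuous f}.
  by apply: derivable_within_continuous => x _; have [] := fdf x.
have [c] := @MVT_segment R f df a b ab (fun x _ => fdf x) cf.
by rewrite in_itv/= => cab fE; exists c.
Qed.

Lemma is_derive_cosh x : is_derive x 1 cosh (sinh x).
Proof.
rewrite /cosh; apply: is_derive_eq; rewrite /sinh /GRing.scale/=.
by rewrite /=; ring.
Qed.

Lemma is_derive_sinh x : is_derive x 1 sinh (cosh x).
Proof.
rewrite /sinh; apply: is_derive_eq; rewrite /cosh /GRing.scale/=.
by rewrite /=; ring.
Qed.

Lemma cosh_ge1 x : 1 <= cosh x.
Proof.
rewrite /cosh ler_pdivlMr//.
have := expR_ge1Dx x; have := expR_ge1Dx (- x); lra.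
Qed.

Lemma cosh_sub1_le x : cosh x - 1 <= x ^+ 2 * expR `|x|.
Proof.
wlog x0 : x / 0 <= x => [hw|].
  have [/hw//|x0] := leP 0 x.
  have -> : cosh x = cosh (- x) by rewrite /cosh opprK addrC.
  by rewrite -sqrrN -normrN; apply: hw; rewrite oppr_ge0 ltW.
rewrite ger0_norm// /cosh; set a := expR (x / 2).
have a0 : 0 < a by exact: expR_gt0.
have ax : expR x = a ^+ 2 by rewrite /a expr2 -expRD -splitr.
have ale : 1 - a^-1 <= x / 2.
  by rewrite -expRN; have := expR_ge1Dx (- (x / 2)); lra.
have a1 : 1 <= a by rewrite -expR0 ler_expR divr_ge0.
have e1 : expR x - 1 <= x * expR x.
  have : expR (- x) * expR x = 1 by rewrite -expRD addNr expR0.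
  have := expR_ge1Dx (- x); have := expR_gt0 x; nra.
rewrite expRN ax; rewrite ax in e1.
(* That is, [cosh x - 1 = (1 - exp (- x))^2 * exp x / 2]; the bound follows from
   [0 <= 1 - exp (- x) <= x]. *)
have -> : (a ^+ 2 + (a ^+ 2)^-1) / 2 - 1 = (1 - a ^- 2) ^+ 2 * a ^+ 2 / 2.
  by field; rewrite gt_eqF.
have h1 : 0 <= 1 - a ^- 2.
  by rewrite subr_ge0 invf_le1 ?exprn_gt0// expr_ge1// ltW.
have h2 : 1 - a ^- 2 <= x.
  rewrite -(ler_pM2r (exprn_gt0 2 a0)) mulrBl mulVf ?gt_eqF ?exprn_gt0//.
  by rewrite mul1r.
have h3 : (1 - a ^- 2) ^+ 2 <= x ^+ 2 by rewrite ler_sqr ?nnegrE.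
have := exprn_gt0 2 a0; nra.
Qed.

Lemma norm_sinh_subl u : `|sinh u - u| <= `|u| ^+ 3 * expR `|u|.
Proof.
wlog u0 : u / 0 <= u => [hw|].
  have [/hw//|u0] := leP 0 u.
  rewrite -normrN (_ : - (sinh u - u) = sinh (- u) - (- u)); last first.
    by rewrite /sinh opprK; ring.
  by rewrite -[in leRHS]normrN; apply: hw; rewrite oppr_ge0 ltW.
have dg x : is_derive x 1 (fun y => sinh y - y) (cosh x - 1).
  by have := is_derive_sinh x => ?; apply: is_derive_eq.
have [c /andP[c0 cu] /=] := MVT_everywhere dg u0.
have -> : sinh 0 = 0 :> R by rewrite /sinh oppr0 subrr mul0r.
rewrite !subr0 => ->.
rewrite normrM ger0_norm ?subr_ge0 ?cosh_ge1// exprSr mulrAC.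
rewrite ler_wpM2r//; apply: (le_trans (cosh_sub1_le c)).
rewrite !ger0_norm//; apply: ler_pM.
- exact: sqr_ge0.
- exact: expR_ge0.
- by rewrite ler_sqr ?nnegrE.
- by rewrite ler_expR.
Qed.

Lemma sinh_subl_ndecr u v : u <= v -> sinh u - u <= sinh v - v.
Proof.
move=> uv.
have dg x : is_derive x 1 (fun y => sinh y - y) (cosh x - 1).
  by have := is_derive_sinh x => ?; apply: is_derive_eq.
have [c _ e] := MVT_everywhere dg uv.
by rewrite -subr_ge0 e mulr_ge0 ?subr_ge0 ?cosh_ge1.
Qed.

(** The derivative [sinh x - x] is nondecreasing. The tangent is taken at [u], the increment of the
    original path, so no size estimate on [v] enters. *)
Lemma cosh_subsqr_convex u v :
  (sinh u - u) * (v - u) <=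
  (cosh v - v ^+ 2 / 2) - (cosh u - u ^+ 2 / 2).
Proof.
have dg x : is_derive x 1 (fun y => cosh y - y ^+ 2 / 2) (sinh x - x).
  have := is_derive_cosh x => ?; apply: is_derive_eq.
  by rewrite !scaler0 add0r /GRing.scale/= !mulr1; field.
have [uv|vu] := leP u v.
  have [c /andP[uc _] ->] := MVT_everywhere dg uv.
  by rewrite ler_wpM2r ?subr_ge0// sinh_subl_ndecr.
have [c /andP[_ cu] e] := MVT_everywhere dg (ltW vu).
rewrite -[leRHS]opprB e -mulrN opprB.
by apply: ler_wnM2r; [rewrite subr_le0 ltW|exact: sinh_subl_ndecr].
Qed.

End hyperbolic.

(** The grid version of the exponent in the theorem, with [gZ] in place of [Z]; it equals the drop
    of the [cosh] energy under [gT (- z)]. *)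
Definition log_main {R : realType} (dt : R) (n : nat) (z : R) (y : rseq R) : R :=
  (cosh (gpath y n) - cosh (gpath y n + z)) / gZ dt y n.

Definition step {R : realType} (y : rseq R) (i : nat) : R :=
  gpath y i.+1 - gpath y i.

(** With [u] the increment and [v] the transformed one, the error of a step is at most
    [|u|^3 * exp |u| * |v - u| / dt]. This is what remains once [u^2] is set aside for [quad_var];
    as [v - u] is of order [dt], it is of order [|u|]. *)
Definition drift {R : realType} (dt : R) (n : nat) (z : R) (y : rseq R)
    (i : nat) : R :=
  `|step y i| * expR `|step y i| *
  `|step (gT dt n z y) i - step y i| / dt.

Definition max_drift {R : realType} (dt : R) (n : nat) (z : R) (y : rseq R) : R :=
  \big[Num.max/0]_(i < n) drift dt n z y i.

Definition quad_var {R : realType} (n : nat) (y : rseq R) : R :=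
  \sum_(i < n) step y i ^+ 2.

Lemma measurable_bigmax d (T : measurableType d) (R : realType) (n : nat)
    (F : nat -> T -> R) : (forall i, measurable_fun setT (F i)) ->
  measurable_fun setT (fun x => \big[Num.max/0]_(i < n) F i x).
Proof.
elim: n F => [|n IH] F mF; first by under eq_fun do rewrite big_ord0; exact: measurable_cst.
under eq_fun do rewrite big_ord_recl.
apply: measurable_maxr; first exact: mF.
exact: (IH (fun i => F i.+1)).
Qed.

Section log_ratio_lower_bound.
Context {R : realType} (dt : R) (n : nat).
Hypotheses (dt0 : 0 < dt) (n0 : (0 < n)%N).
Implicit Types (y : rseq R) (z : R).

(* Convexity of [cosh x - x^2 / 2] gives a one-sided error, of third order in the
   increments of [y] and first order in those of [gT y - y]. *)
Lemma log_ratio_ge z y :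
  log_main dt n z y - max_drift dt n (- z) y * quad_var n y <=
  log_ratio dt n z y.
Proof.
pose u i := step y i.
pose v i := step (gT dt n (- z) y) i.
have -> : log_main dt n z y =
    \sum_(i < n) (cosh (u i) / dt - cosh (v i) / dt).
  have e := gT_energy dt0 n0 (- z) y.
  rewrite sumrB /u /v /step e opprK opprD addNKr.
  by rewrite /log_main !mulrBl opprB.
rewrite /quad_var mulr_sumr -sumrB /log_ratio; apply: ler_sum => i _.
rewrite -/(step y i) -/(step (gT _ _ _ _) i) -/(u i) -/(v i); set X := max_drift _ _ _ _.
have hX : `|u i| * expR `|u i| * `|v i - u i| / dt <= X.
  exact: (le_bigmax 0 (fun i : 'I_n => drift dt n (- z) y i) i).
have h1 := cosh_subsqr_convex (u i) (v i).
have h2 : - (`|u i| ^+ 3 * expR `|u i| * `|v i - u i|) <=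
          (sinh (u i) - u i) * (v i - u i).
  rewrite lerNl; apply: (le_trans (ler_norm _)).
  by rewrite normrN normrM ler_wpM2r// norm_sinh_subl.
have h3 : `|u i| ^+ 3 * expR `|u i| * `|v i - u i| <= dt * (X * u i ^+ 2).
  have -> : `|u i| ^+ 3 * expR `|u i| * `|v i - u i| =
      dt * ((`|u i| * expR `|u i| * `|v i - u i| / dt) * u i ^+ 2).
    rewrite exprSr -normrX ger0_norm ?sqr_ge0//.
    by field; rewrite gt_eqF.
  by rewrite ler_pM2l// ler_wpM2r// sqr_ge0.
rewrite -(ler_pM2l dt0).
have -> : dt * (cosh (u i) / dt - cosh (v i) / dt - X * u i ^+ 2) =
   cosh (u i) - cosh (v i) - dt * (X * u i ^+ 2).
  by field; rewrite gt_eqF.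
have -> : dt * ((u i ^+ 2 - v i ^+ 2) / (2 * dt)) = (u i ^+ 2 - v i ^+ 2) / 2.
  by field; rewrite gt_eqF.
lra.
Qed.

Lemma max_drift_ge0 z y : 0 <= max_drift dt n z y.
Proof. exact: bigmax_ge_id. Qed.

Lemma measurable_step i : measurable_fun [set: rseq R] (fun y => step y i).
Proof. by apply: measurable_funB; exact: measurable_gpath. Qed.

Lemma measurable_max_drift z : measurable_fun setT (max_drift dt n z).
Proof.
apply: (measurable_bigmax n (F := fun i y => drift dt n z y i)) => i.
have mu := measurable_step i.
have mv := measurableT_comp mu (measurable_gT dt0 n z).
have mnu : measurable_fun [set: rseq R] (fun y => `|step y i|).
  exact: measurableT_comp.
apply: measurable_funM => //; apply: measurable_funM.
  by apply: measurable_funM => //; exact: measurableT_comp.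
by apply: measurableT_comp => //; exact: measurable_funB.
Qed.

Lemma measurable_quad_var : measurable_fun setT (@quad_var R n).
Proof.
apply: measurable_sum => i; apply: measurable_funX.
exact: measurable_step.
Qed.

Lemma measurable_cosh : measurable_fun setT (@cosh R).
Proof.
apply: measurable_funM => //; apply: measurable_funD => //.
by apply: measurableT_comp.
Qed.

Lemma measurable_log_main z : measurable_fun setT (log_main dt n z).
Proof.
apply: measurable_funM.
  apply: measurable_funB; apply: (measurableT_comp measurable_cosh).
    exact: measurable_gpath.
  by apply: measurable_funD => //; exact: measurable_gpath.
apply: measurable_funVr; last exact: measurable_gZ.
by move=> y; rewrite mulr_gt0 ?expR_gt0 ?gA_gt0.
Qed.

End log_ratio_lower_bound.

(** * Limits along a continuous path *)

Section uniform_continuity.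
Context {R : realType} (t : R).
Hypothesis t0 : 0 < t.

Lemma within_continuous_dist (f : R -> R) (x e : R) :
  {within `[0, t], continuous f} -> 0 <= x <= t -> 0 < e ->
  exists2 r, 0 < r & forall y, 0 <= y <= t -> `|x - y| < r -> `|f x - f y| < e.
Proof.
move=> /subspace_continuousP cf xt e0.
have : f @ within `[0, t] (nbhs x) --> f x by apply: cf; rewrite /= in_itv.
move=> /cvgrPdist_lt/(_ e e0); rewrite /= near_withinE.
move=> /nbhs_ballP[r /= r0 hr]; exists r => // y yt xy.
by apply: hr => //=; rewrite in_itv.
Qed.

Lemma grid_step_cvg : t / n.+1%:R @[n --> \oo] --> (0 : R).
Proof.
rewrite -[X in _ --> X](mulr0 t); apply: cvgM; first exact: cvg_cst.
exact: cvg_harmonic.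
Qed.

Lemma grid_step_lt (e : R) : 0 < e -> \forall n \near \oo, t / n.+1%:R < e.
Proof.
move=> e0; have /cvgrPdist_lt/(_ e e0) := grid_step_cvg.
apply: filterS => n; rewrite sub0r normrN; exact: le_lt_trans (ler_norm _).
Qed.

(** Heine's theorem with the mesh as modulus, from compactness of the segment. *)
Lemma unif_continuous_grid (f : R -> R) (e : R) :
  {within `[0, t], continuous f} -> 0 < e ->
  \forall n \near \oo, forall x y, 0 <= x <= t -> 0 <= y <= t ->
    `|x - y| <= t / n.+1%:R -> `|f x - f y| <= e.
Proof.
move=> cf e0.
have cpt : near_covering_within (`[0, t] : set R).
  exact/near_covering_withinP/compact_near_coveringP/segment_compact.
pose Q (n : nat) (x : R) := forall y, 0 <= y <= t ->
    `|x - y| <= t / n.+1%:R -> `|f x - f y| <= e.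
have := cpt nat \oo Q _; case.
- move=> x; rewrite /= in_itv/= => xt.
  have e20 : 0 < e / 2 by rewrite divr_gt0.
  have [r r0 hr] := within_continuous_dist cf xt e20.
  (* Half of the radius goes to the centre [x'] and half to the mesh, so that both [x'] and [y] stay
     within [r] of [x]. *)
  have r20 : 0 < r / 2 by rewrite divr_gt0.
  exists (ball x (r / 2), [set n | t / n.+1%:R < r / 2]) => /=.
    by split; [exact: nbhsx_ballx|exact: grid_step_lt].
  move=> [x' n] /= [xx' nr]; rewrite in_itv/= => x't y yt x'y.
  rewrite /ball/= in xx'.
  have xy : `|x - y| < r.
    have -> : x - y = (x - x') + (x' - y) by ring.
    apply: (le_lt_trans (ler_normD _ _)).
    rewrite [ltRHS]splitr; apply: ltrD => //.
    exact: le_lt_trans nr.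
  have xx'r : `|x - x'| < r by apply: (lt_trans xx'); lra.
  have h1 := hr _ yt xy; have h2 := hr _ x't xx'r.
  have -> : f x' - f y = (f x - f y) - (f x - f x') by ring.
  by apply: (le_trans (ler_normB _ _)); rewrite [leRHS]splitr lerD// ltW.
- move=> N _ hN; exists N => // n /hN h x y xt.
  by apply: h; rewrite /= in_itv.
Qed.

Lemma within_continuous_bounded (f : R -> R) :
  {within `[0, t], continuous f} ->
  exists S, forall x, 0 <= x <= t -> `|f x| <= S.
Proof.
move=> cf; have [c _ hc] := EVT_max (ltW t0) cf.
have [c' _ hc'] := EVT_min (ltW t0) cf.
exists (`|f c| + `|f c'|) => x xt.
have := hc x; rewrite in_itv /= => /(_ xt) h1.
have := hc' x; rewrite in_itv /= => /(_ xt) h2.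
rewrite ler_norml; apply/andP; split.
  rewrite lerNl (le_trans (_ : _ <= - f c'))// ?lerN2//.
  by rewrite (le_trans (ler_norm _))// normrN lerDr.
by rewrite (le_trans h1)// (le_trans (ler_norm _))// lerDl.
Qed.

End uniform_continuity.

Section path_limits.
Context {R : realType} (t : R) (f : R -> R).
Hypotheses (t0 : 0 < t) (cf : {within `[0, t], continuous f}) (f0 : f 0 = 0).
Local Notation dt n := (t / n.+1%:R).
Local Notation mu := (@lebesgue_measure R).

(** Shaped so that the grid of the centred Brownian path is, by conversion, an instance. *)
Definition ygrid (n : nat) : rseq R :=
  fun i => if (i < n.+1)%N then f (i.+1%:R * dt n) else 0.

Let dt0 n : 0 < dt n. Proof. by rewrite divr_gt0. Qed.

Let dtn n : n.+1%:R * dt n = t.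
Proof. by rewrite mulrC divfK// pnatr_eq0. Qed.

Lemma grid_pt n i : (i <= n.+1)%N -> 0 <= i%:R * dt n <= t.
Proof.
move=> ni; rewrite mulr_ge0 ?(ltW (dt0 n))//= -[leRHS](dtn n).
by rewrite ler_pM2r// ler_nat.
Qed.

Lemma gpath_ygrid n i : (i <= n.+1)%N -> gpath (ygrid n) i = f (i%:R * dt n).
Proof. by case: i => [|i] ni; rewrite /= ?mul0r ?f0// /ygrid ni. Qed.

Lemma exp2_within_continuous :
  {within `[0, t], continuous (fun u => expR (2 * f u))}.
Proof.
have c2 : continuous (fun x : R => expR (2 * x)).
  move=> y; apply: (@continuous_comp _ _ _ (fun x : R => 2 * x) expR).
    exact: mulrl_continuous.
  exact: continuous_expR.
apply: (@within_continuous_comp _ _ _ _ f (fun x : R => expR (2 * x))); last first.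
  exact: cf.
by move=> x _; exact: c2.
Qed.

Lemma exp2_integrable_path : mu.-integrable `[0, t] (EFin \o (fun u => expR (2 * f u))).
Proof.
apply: continuous_compact_integrable; first exact: segment_compact.
exact: exp2_within_continuous.
Qed.

Lemma expA_within_continuous : {within `[0, t], continuous (expA f)}.
Proof. exact: (parameterized_integral_continuous (ltW t0) exp2_integrable_path). Qed.

Lemma expA_le_path x y : 0 <= x -> x <= y -> y <= t -> expA f x <= expA f y.
Proof.
move=> x0 xy yt; have iy : mu.-integrable `[0, y] (EFin \o (fun u => expR (2 * f u))).
  by apply: (integrableS _ _ _ exp2_integrable_path) => //; exact: subset_itvl.
rewrite -subr_ge0 /expA Rintegral_itvB//.
  by apply: Rintegral_ge0 => u _; exact: expR_ge0.
Qed.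

Lemma expA_incr_bounds (a b m M : R) : 0 <= a -> a <= b -> b <= t ->
  (forall u, a < u <= b -> m <= expR (2 * f u) <= M) ->
  m * (b - a) <= expA f b - expA f a <= M * (b - a).
Proof.
move=> a0 ab bt hm.
have ib : mu.-integrable `[0, b] (EFin \o (fun u => expR (2 * f u))).
  by apply: (integrableS _ _ _ exp2_integrable_path) => //; exact: subset_itvl.
have iab : mu.-integrable `]a, b] (EFin \o (fun u => expR (2 * f u))).
  by apply: (integrableS _ _ _ ib) => //; apply: subset_itvr; rewrite bnd_simp.
have muE : mu `]a, b]%classic = (b - a)%:E.
  rewrite lebesgue_measure_itv /= lte_fin.
  by case: ltgtP ab => //= ->; rewrite subrr.
have lenE (c : R) : \int[mu]_(u in `]a, b]) c = c * (b - a).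
  transitivity (c * fine (mu `]a, b]%classic)); first exact: Rintegral_cst.
  by rewrite muE.
have icst (c : R) : mu.-integrable `]a, b] (EFin \o cst c).
  apply: (@integrableS _ _ _ mu `[a, b]) => //.
    by apply: subset_itvr; rewrite bnd_simp.
  apply: continuous_compact_integrable; first exact: segment_compact.
  by apply: continuous_subspaceT => x; exact: cst_continuous.
rewrite /expA Rintegral_itvB//; apply/andP; split.
- rewrite -lenE; apply: le_Rintegral; [by []|exact: icst|exact: iab|].
  by move=> u; rewrite /= in_itv/= => /hm/andP[].
- rewrite -lenE; apply: le_Rintegral; [by []|exact: iab|exact: icst|].
  by move=> u; rewrite /= in_itv/= => /hm/andP[].
Qed.

Lemma expA0 : expA f 0 = 0.
Proof. by rewrite /expA set_itv1 Rintegral_set1. Qed.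

(** On a mesh cell [2 * f u] differs from the sum of the two end values by at most [2 * e]. Kept
    multiplicative, this bound adds up over the cells without growing with their number. *)
Lemma gA_expA_sandwich (e : R) : 0 < e -> \forall n \near \oo,
  forall i, (i <= n.+1)%N ->
    expR (- (2 * e)) * gA (dt n) (ygrid n) i <= expA f (i%:R * dt n) <=
    expR (2 * e) * gA (dt n) (ygrid n) i.
Proof.
move=> e0; have := unif_continuous_grid cf e0; apply: filterS => n hn.
elim=> [_|i IH ni]; first by rewrite mul0r expA0 /gA big_ord0 !mulr0 lexx.
have := IH (ltnW ni) => /andP[l1 l2].
have ga := grid_pt (ltnW ni); have gb := grid_pt ni.
set a := i%:R * dt n in l1 l2 ga *; set b := i.+1%:R * dt n in gb *.
have /andP[a0 a1] := ga; have /andP[b0 b1] := gb.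
have ba : b - a = dt n by rewrite /a /b -mulrBl -natrB// subSnn mul1r.
have ab : a <= b by rewrite -subr_ge0 ba ltW.
have fS u : a < u <= b -> f a + f b - 2 * e <= 2 * f u <= f a + f b + 2 * e.
  move=> /andP[au ub].
  have ut : 0 <= u <= t.
    by rewrite (le_trans a0 (ltW au)) (le_trans ub b1).
  have h1 : `|u - a| <= dt n by rewrite ger0_norm ?subr_ge0 ?(ltW au)// -ba lerD2r.
  have h2 : `|u - b| <= dt n.
    by rewrite distrC ger0_norm ?subr_ge0// -ba lerD2l lerN2 ltW.
  have := hn _ _ ut ga h1; have := hn _ _ ut gb h2.
  by rewrite !ler_norml => /andP[? ?] /andP[? ?]; apply/andP; split; lra.
have := @expA_incr_bounds a b (expR (f a + f b - 2 * e)) (expR (f a + f b + 2 * e))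
  a0 ab b1.
have hb u : a < u <= b ->
    expR (f a + f b - 2 * e) <= expR (2 * f u) <= expR (f a + f b + 2 * e).
  by move=> /fS/andP[? ?]; rewrite !ler_expR; apply/andP.
move=> /(_ hb); rewrite ba => /andP[h1 h2].
rewrite gAS (gpath_ygrid (ltnW ni)) (gpath_ygrid ni) -/a -/b !mulrDr.
move: h1 h2; rewrite !(expRD (f a + f b)).
set E := expR (f a + f b) => h1 h2.
have e1 : expR (- (2 * e)) * (dt n * E) = E * expR (- (2 * e)) * dt n by ring.
have e2 : expR (2 * e) * (dt n * E) = E * expR (2 * e) * dt n by ring.
rewrite e1 e2; apply/andP; split.
  by have := lerD l1 h1; rewrite [X in _ <= X]addrC subrK.
by have := lerD l2 h2; rewrite [X in X <= _]addrC subrK.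
Qed.

Lemma gA_expA_unif (e : R) : 0 < e -> \forall n \near \oo,
  forall i, (i <= n.+1)%N ->
    `|gA (dt n) (ygrid n) i - expA f (i%:R * dt n)| <= e.
Proof.
(* [r] is chosen with [exp (2 * r) - 1 = e / M], which turns the relative error into an absolute
   one. The added 1 secures [0 < M]; positivity of [expA f t] is itself derived from this lemma
   later. *)
move=> e0; pose M := expA f t + 1.
have M0 : 0 < M by rewrite ltr_wpDl// expA_ge0.
pose r := ln (1 + e / M) / 2.
have eM : 0 < e / M by rewrite divr_gt0.
have r0 : 0 < r by rewrite divr_gt0// ln_gt0// ltrDl.
have rE : expR (2 * r) = 1 + e / M.
  by rewrite /r mulrC divfK// lnK// posrE addr_gt0.
have := gA_expA_sandwich r0; apply: filterS => n hn i ni.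
have /andP[h1 h2] := hn i ni.
have AM : expA f (i%:R * dt n) <= M.
  have /andP[g0 g1] := grid_pt ni.
  by apply: (@le_trans _ _ (expA f t)); [exact: expA_le_path|rewrite lerDl].
have A0 := expA_ge0 f (i%:R * dt n).
move: h1 h2; rewrite expRN rE; set q := e / M in eM *.
set g := gA _ _ _; set A := expA _ _ in AM A0 * => h1 h2.
have qM : q * M = e by rewrite /q divfK// gt_eqF.
have q1 : 0 < 1 + q by rewrite addr_gt0.
have h3 : g <= A * (1 + q) by rewrite -ler_pdivrMr// mulrC.
have h4 : q * A <= e by rewrite -qM ler_pM2l.
have g0 : 0 <= g by apply: gA_ge0; exact: dt0.
have h5 : A <= g + q * g by move: h2; rewrite mulrDl mul1r.
have [gA'|Ag] := leP A g.
  by rewrite ger0_norm ?subr_ge0//; lra.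
have h6 : q * g <= q * A by rewrite ler_pM2l// ltW.
by rewrite ltr0_norm ?subr_lt0//; lra.
Qed.

End path_limits.

(** The transformation on plain functions, which also applies to the centred path without packing it
    as a [cpath]. *)
Definition transf {R : realType} (t z : R) (f : R -> R) (s : R) : R :=
  f s - ln (1 + expA f s / expA f t * (expR z - 1)).

Definition log_density {R : realType} (t z : R) (f : R -> R) : R :=
  (cosh (f t) - cosh (f t + z)) / expZ f t.

Section grid_limits.
Context {R : realType} (t : R) (f : R -> R).
Hypotheses (t0 : 0 < t) (cf : {within `[0, t], continuous f}) (f0 : f 0 = 0).
Local Notation dt n := (t / n.+1%:R).
Local Notation yg := (ygrid t f).

Let dt0 n : 0 < dt n. Proof. by rewrite divr_gt0. Qed.

Let dtn n : n.+1%:R * dt n = t.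
Proof. by rewrite mulrC divfK// pnatr_eq0. Qed.

Definition grid_index (n : nat) (s : R) : nat := Num.trunc (s / dt n).

Lemma grid_index_le n s : 0 <= s <= t -> (grid_index n s <= n.+1)%N.
Proof.
move=> /andP[s0 st]; have /truncn_itv/andP[h _] : 0 <= s / dt n.
  by rewrite divr_ge0// ltW.
rewrite -(ler_nat R) (le_trans h)// ler_pdivrMr// dtn//.
Qed.

Lemma grid_index_dist n s : 0 <= s <= t ->
  `|s - (grid_index n s)%:R * dt n| <= dt n.
Proof.
move=> /andP[s0 st]; have /truncn_itv/andP[h1 h2] : 0 <= s / dt n.
  by rewrite divr_ge0// ltW.
rewrite ler_pdivlMr// in h1; rewrite ltr_pdivrMr// in h2.
rewrite ger0_norm ?subr_ge0// lerBlDl (le_trans (ltW h2))//.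
by rewrite -natr1 mulrDl mul1r addrC.
Qed.

Lemma grid_index_cvg (g : R -> R) s : {within `[0, t], continuous g} ->
  0 <= s <= t -> g ((grid_index n s)%:R * dt n) @[n --> \oo] --> g s.
Proof.
move=> cg st; apply/cvgrPdist_le => e e0.
have := unif_continuous_grid cg e0; apply: filterS => n hn.
apply: hn => //; last exact: grid_index_dist.
by apply: (grid_pt t0); exact: grid_index_le.
Qed.

Lemma gpath_index_cvg s : 0 <= s <= t ->
  gpath (yg n) (grid_index n s) @[n --> \oo] --> f s.
Proof.
move=> st; rewrite (_ : (fun n => _) = fun n => f ((grid_index n s)%:R * dt n)).
  exact: grid_index_cvg.
by apply/funext => n; rewrite gpath_ygrid// grid_index_le.
Qed.

Lemma gpath_end n : gpath (yg n) n.+1 = f t.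
Proof. by rewrite gpath_ygrid// dtn. Qed.

Lemma gA_index_cvg s : 0 <= s <= t ->
  gA (dt n) (yg n) (grid_index n s) @[n --> \oo] --> expA f s.
Proof.
move=> st; apply/cvgrPdist_le => e e0.
have e20 : 0 < e / 2 by rewrite divr_gt0.
have := gA_expA_unif t0 cf f0 e20.
have /cvgrPdist_le/(_ _ e20) := grid_index_cvg (expA_within_continuous t0 cf) st.
apply: filterS2 => n h1 /(_ _ (grid_index_le n st)) h2.
set A := expA f (_ * _) in h1 h2; set g := gA _ _ _ in h2 *.
have -> : expA f s - g = (expA f s - A) - (g - A) by ring.
by rewrite (le_trans (ler_normB _ _))// [leRHS]splitr lerD.
Qed.

Lemma gA_end_cvg : gA (dt n) (yg n) n.+1 @[n --> \oo] --> expA f t.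
Proof.
apply/cvgrPdist_le => e e0.
have := gA_expA_unif t0 cf f0 e0.
by apply: filterS => n /(_ n.+1 (leqnn _)); rewrite dtn distrC.
Qed.

Lemma gA_end_ge (S : R) n : (forall x, 0 <= x <= t -> `|f x| <= S) ->
  t * expR (- (2 * S)) <= gA (dt n) (yg n) n.+1.
Proof.
move=> hS.
have -> : t * expR (- (2 * S)) = \sum_(i < n.+1) dt n * expR (- (2 * S)).
  by rewrite sumr_const card_ord -[RHS]mulr_natl mulrA dtn.
apply: ler_sum => i _.
rewrite ler_pM2l// ler_expR !gpath_ygrid//; last exact: ltnW.
have := hS _ (grid_pt t0 (ltn_ord i)); have := hS _ (grid_pt t0 (ltnW (ltn_ord i))).
by rewrite !ler_norml => /andP[? ?] /andP[? ?]; lra.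
Qed.

(** A limit of grid sums that are all at least [t * exp (- 2 * S)], where [S] bounds the path. *)
Lemma expA_gt0 : 0 < expA f t.
Proof.
have [S hS] := within_continuous_bounded t0 cf.
apply: (@lt_le_trans _ _ (t * expR (- (2 * S)))); first by rewrite mulr_gt0 ?expR_gt0.
rewrite -(cvg_lim _ gA_end_cvg)//; apply: limr_ge; first exact: cvgP gA_end_cvg.
by apply: nearW => n; exact: gA_end_ge.
Qed.

Lemma expA_ratio_gt0 z s : 0 <= s <= t ->
  0 < 1 + expA f s / expA f t * (expR z - 1).
Proof.
move=> /andP[s0 st]; have At := expA_gt0.
have r0 : 0 <= expA f s / expA f t by rewrite divr_ge0 ?expA_ge0.
have r1 : expA f s / expA f t <= 1.
  by rewrite ler_pdivrMr// mul1r (expA_le_path cf).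
set r := expA f s / _ in r0 r1 *.
have := expR_gt0 z; move: (expR z) => q q0.
have [->|rn] := eqVneq r 0; first by rewrite mul0r addr0.
have rp : 0 < r by rewrite lt_neqAle eq_sym rn.
have : 0 < r * q by rewrite mulr_gt0.
lra.
Qed.

Lemma gT_index_cvg z s : 0 <= s <= t ->
  gpath (gT (dt n) n.+1 z (yg n)) (grid_index n s) @[n --> \oo] -->
  transf t z f s.
Proof.
move=> st.
rewrite (_ : (fun n => _) = fun n => gpath (yg n) (grid_index n s) -
    ln (1 + gA (dt n) (yg n) (grid_index n s) / gA (dt n) (yg n) n.+1 *
      (expR z - 1))).
  apply: cvgB; first exact: gpath_index_cvg.
  apply: (cvg_comp _ (@ln R)); last first.
    exact/continuous_ln/(expA_ratio_gt0 z st).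
  apply: cvgD; first exact: cvg_cst.
  apply: cvgM; last exact: cvg_cst.
  apply: cvgM; first exact: gA_index_cvg.
  by apply: cvgV; [rewrite gt_eqF// expA_gt0|exact: gA_end_cvg].
apply/funext => n; rewrite gpath_gT//; exact: grid_index_le.
Qed.

Lemma log_main_cvg z :
  log_main (dt n) n.+1 z (yg n) @[n --> \oo] --> log_density t z f.
Proof.
rewrite /log_main /log_density; under eq_fun do rewrite gpath_end.
apply: cvgM; first exact: cvg_cst.
apply: cvgV; first by rewrite gt_eqF// mulr_gt0 ?expR_gt0 ?expA_gt0.
rewrite /gZ; under eq_fun do rewrite gpath_end.
by apply: cvgM; [exact: cvg_cst|exact: gA_end_cvg].
Qed.

Lemma ln_dist_le (k a b : R) : 0 < k -> k <= a -> k <= b ->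
  `|ln a - ln b| <= `|a - b| / k.
Proof.
move=> k0; wlog ba : a b / b <= a => [hw|] ka kb.
  have [/hw|/ltW/hw] := leP b a; first exact.
  by rewrite distrC [in X in _ -> _ <= X]distrC; exact.
have a0 := lt_le_trans k0 ka; have b0 := lt_le_trans k0 kb.
rewrite !ger0_norm ?subr_ge0 ?ler_ln ?posrE// -ln_div ?posrE//.
have -> : a / b = 1 + (a - b) / b by rewrite mulrBl divff ?gt_eqF// addrC subrK.
apply: (le_trans (le_ln1Dx _)).
  by rewrite (lt_le_trans (ltrN10 _))// divr_ge0 ?subr_ge0// ltW.
by rewrite ler_wpM2l ?subr_ge0// lef_pV2 ?posrE.
Qed.

(** The path is shifted by [ln] of a factor that is bounded away from 0 and changes by [O(dt)] per
    cell. So [|v - u| / dt] stays bounded, and the remaining factor [|u|] is uniformly small by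
    uniform continuity. *)
Lemma max_drift_cvg z :
  max_drift (dt n) n.+1 z (yg n) @[n --> \oo] --> (0 : R).
Proof.
have [S hS] := within_continuous_bounded t0 cf.
pose k := Num.min 1 (expR z).
have k0 : 0 < k by rewrite lt_min ltr01 expR_gt0.
(* The first factor bounds [exp |u|], since [|u| <= 2 * S]. The second bounds [|v - u| / dt]: the
   increment of [gw] is controlled by [gA >= t * exp (- 2 * S)], and [ln] has Lipschitz constant
   [1 / k] above [k]. *)
pose C := expR (2 * S) * (`|expR z - 1| * expR (2 * S) / (t * expR (- (2 * S))) / k).
have C0 : 0 <= C.
  by rewrite mulr_ge0 ?expR_ge0// divr_ge0 ?(ltW k0)// divr_ge0 ?mulr_ge0 ?expR_ge0// ltW.
apply/cvgrPdist_le => e e0.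
have eC : 0 < e / (C + 1) by rewrite divr_gt0// ltr_wpDl.
have := unif_continuous_grid cf eC; apply: filterS => n hn.
rewrite sub0r normrN ger0_norm ?max_drift_ge0//.
apply: bigmax_le => [|i _]; first exact: ltW.
have ni := ltn_ord i; have ni' := ltnW ni.
have gi := grid_pt t0 ni'; have gi1 := grid_pt t0 ni.
have stepE : step (yg n) i = f (i.+1%:R * dt n) - f (i%:R * dt n).
  by rewrite /step !gpath_ygrid.
have stepS : `|step (yg n) i| <= 2 * S.
  rewrite stepE; have := hS _ gi; have := hS _ gi1.
  have := ler_normB (f (i.+1%:R * dt n)) (f (i%:R * dt n)); lra.
have step_e : `|step (yg n) i| <= e / (C + 1).
  rewrite stepE; apply: hn => //.
  by rewrite -mulrBl -natrB// subSnn mul1r ger0_norm// ltW.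
have sumS : expR (gpath (yg n) i) * expR (gpath (yg n) i.+1) <= expR (2 * S).
  rewrite -expRD ler_expR !gpath_ygrid//.
  have := hS _ gi; have := hS _ gi1.
  by rewrite !ler_norml => /andP[? ?] /andP[? ?]; lra.
have driftE : step (gT (dt n) n.+1 z (yg n)) i - step (yg n) i =
    ln (gw (dt n) n.+1 z (yg n) i) - ln (gw (dt n) n.+1 z (yg n) i.+1).
  by rewrite /step !gpath_gT//; ring.
have hb : `|step (gT (dt n) n.+1 z (yg n)) i - step (yg n) i| / dt n <=
    `|expR z - 1| * expR (2 * S) / (t * expR (- (2 * S))) / k.
  rewrite ler_pdivrMr// driftE.
  apply: (le_trans (ln_dist_le k0 (gw_ge (dt0 n) (ltn0Sn n) _ _ ni')
    (gw_ge (dt0 n) (ltn0Sn n) _ _ ni))).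
  have An : 0 < gA (dt n) (yg n) n.+1 by exact: gA_gt0.
  rewrite distrC gwS addrC addKr.
  move: sumS; set p := expR (gpath _ _); set q := expR (gpath _ _) => sumS.
  set g := gA _ _ _ in An *; set D := dt n.
  have pq0 : 0 <= p * q by apply: mulr_ge0; exact: expR_ge0.
  have D0 : 0 <= D by exact: ltW (dt0 n).
  have pqgD0 : 0 <= p * q / g * D.
    by apply: mulr_ge0 => //; apply: divr_ge0 => //; exact: ltW.
  have -> : (expR z - 1) / g * D * p * q = (expR z - 1) * (p * q / g * D) by ring.
  rewrite normrM (ger0_norm pqgD0).
  have -> : `|expR z - 1| * (p * q / g * D) / k =
      `|expR z - 1| * (p * q) / g / k * D by ring.
  apply: ler_wpM2r => //; apply: ler_wpM2r; first by rewrite invr_ge0 ltW.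
  have tS : 0 < t * expR (- (2 * S)) by rewrite mulr_gt0 ?expR_gt0.
  apply: ler_pM.
  - exact: mulr_ge0.
  - by rewrite invr_ge0 ltW.
  - exact: ler_wpM2l.
  - by rewrite lef_pV2 ?posrE//; exact: gA_end_ge.
have d0 : 0 <= `|step (gT (dt n) n.+1 z (yg n)) i - step (yg n) i| / dt n.
  by apply: divr_ge0 => //; exact: ltW.
rewrite /drift -mulrA -mulrA.
apply: (@le_trans _ _ (e / (C + 1) * C)).
  apply: ler_pM; [exact: normr_ge0| |exact: step_e|].
    by apply: mulr_ge0; [exact: expR_ge0|exact: d0].
  apply: ler_pM; [exact: expR_ge0|exact: d0| |exact: hb].
  by rewrite ler_expR.
by rewrite -mulrA ler_piMr ?(ltW e0)// mulrC ler_pdivrMr ?mul1r ?lerDl// ltr_wpDl.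
Qed.

End grid_limits.

(** * Passage to the limit *)

Section bounded_convergence.
Context d (T : measurableType d) (R : realType) (P : probability T R).

Lemma cvg_integral_bounded (u : nat -> T -> R) (v : T -> R) (M : R) :
  (forall n, measurable_fun setT (u n)) -> (forall n w, 0 <= u n w <= M) ->
  (forall w, u n w @[n --> \oo] --> v w) ->
  measurable_fun setT v /\
  (\int[P]_w (u n w)%:E @[n --> \oo] --> \int[P]_w (v w)%:E)%E.
Proof.
move=> mu uM uv.
have mv : measurable_fun setT v.
  by apply: (measurable_fun_cvg mu) => w _; exact: uv.
split=> //.
have iM : P.-integrable setT (EFin \o cst M) by exact: finite_measure_integrable_cst.
have mun n : measurable_fun setT (fun w => (u n w)%:E) by exact/measurable_EFinP.
have mve : measurable_fun setT (fun w => (v w)%:E) by exact/measurable_EFinP.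
have aecv : {ae P, forall w, [set: T] w ->
    (fun n => (u n w)%:E) @ \oo --> (v w)%:E}.
  by apply: aeW => w _; apply: cvg_EFin; [exact: nearW|exact: uv].
have aebd : {ae P, forall w, forall n, [set: T] w ->
    (`|(u n w)%:E| <= (EFin \o cst M) w)%E}.
  apply: aeW => w n _ /=; have /andP[u0 uM'] := uM n w.
  by rewrite lee_fin ger0_norm.
have [? ? h] := dominated_convergence measurableT mun mve aecv iM aebd.
exact: h.
Qed.

End bounded_convergence.

(** * A bound on the second moment of a centred Gaussian law *)

Section normal_second_moment.
Context {R : realType}.

Lemma normal_peak_sqrt_le (x : R) : 0 < x ->
  normal_peak (Num.sqrt x) <= 2 * normal_peak (Num.sqrt (2 * x)).
Proof.
move=> x0; rewrite /normal_peak !sqr_sqrtr ?mulr_ge0 ?(ltW x0)//.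
have p0 : 0 < x * pi *+ 2 by rewrite pmulrn_lgt0// mulr_gt0// pi_gt0.
have -> : 2 * x * pi *+ 2 = 2 * (x * pi *+ 2) by rewrite -mulrA mulrnAr.
rewrite -[leLHS]invrK -[X in _ <= 2 * X]div1r mulrA mulr1 !invrK.
rewrite ler_pdivlMr ?sqrtr_gt0 ?mulr_gt0// mulrC ler_pdivrMr ?sqrtr_gt0//.
rewrite sqrtrM// ler_wpM2r ?sqrtr_ge0//.
by rewrite -(@ler_sqr _ _ 2) ?nnegrE ?sqrtr_ge0// sqr_sqrtr//; lra.
Qed.

(** The square is absorbed by half of the exponent: [v * exp (- v) <= 1] for [v = x^2 / (4 * s)],
    leaving a Gaussian of variance [2 * s]. The constant 8 is 4 from [v] times 2, a bound for the
    ratio [sqrt 2] of the peaks. *)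
Lemma sqr_normal_pdf_le (s x : R) : 0 < s ->
  x ^+ 2 * normal_pdf 0 (Num.sqrt s) x <=
  8 * s * normal_pdf 0 (Num.sqrt (2 * s)) x.
Proof.
move=> s0; have s20 : 0 < 2 * s by rewrite mulr_gt0.
rewrite !normal_pdfE ?sqrtr_eq0 -?ltNge// /normal_fun !subr0.
rewrite !sqr_sqrtr ?(ltW s0) ?(ltW s20)//.
pose v := x ^+ 2 / (4 * s).
have -> : - x ^+ 2 / (s *+ 2) = - v + - v.
  by rewrite /v -mulr_natl; field; rewrite gt_eqF.
have -> : - x ^+ 2 / (2 * s *+ 2) = - v.
  by rewrite /v -mulr_natl; field; rewrite gt_eqF.
have xE : x ^+ 2 = 4 * s * v by rewrite /v; field; rewrite gt_eqF.
have v0 : 0 <= v by rewrite /v divr_ge0 ?sqr_ge0// mulr_ge0// ltW.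
have ve : v * expR (- v) <= 1.
  rewrite expRN ler_pdivrMr ?expR_gt0// mul1r.
  by apply: (le_trans _ (expR_ge1Dx v)); rewrite lerDr.
have pk := normal_peak_sqrt_le s0.
have pk0 := normal_peak_ge0 (Num.sqrt s).
rewrite xE expRD; set e := expR (- v) in ve *.
have e0 : 0 < e by exact: expR_gt0.
set p := normal_peak _ in pk pk0 *; set q := normal_peak _ in pk *.
have -> : 4 * s * v * (p * (e * e)) = 4 * s * e * ((v * e) * p) by ring.
have -> : 8 * s * (q * e) = 4 * s * e * (2 * q) by ring.
rewrite ler_pM2l ?mulr_gt0//.
by apply: (le_trans _ pk); rewrite ler_piMl.
Qed.

Lemma normal_second_moment_le (s : R) : 0 < s ->
  (\int[normal_prob 0 (Num.sqrt s)]_x (x ^+ 2)%:E <= (8 * s)%:E)%E.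
Proof.
move=> s0.
have msq : measurable_fun setT (fun x : R => (x ^+ 2)%:E).
  by apply/measurable_EFinP; exact: measurable_funX.
rewrite ge0_integral_normal_prob//; last by move=> x; rewrite lee_fin sqr_ge0.
rewrite -[leRHS]mule1 -(integral_normal_pdf 0 (Num.sqrt (2 * s))).
have mpdf (r : R) : measurable_fun setT (fun x : R => (normal_pdf 0 r x)%:E).
  by apply/measurable_EFinP; exact: measurable_normal_pdf.
rewrite -ge0_integralZl//; last 2 first.
- by move=> x _; rewrite lee_fin normal_pdf_ge0.
- by rewrite lee_fin mulr_ge0// ltW.
apply: ge0_le_integral => //.
- by move=> x _; rewrite mule_ge0// lee_fin ?normal_pdf_ge0 ?sqr_ge0.
- by apply: emeasurable_funM => //; exact: mpdf.
- by apply: measurable_funeM; exact: mpdf.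
- by move=> x _; rewrite -!EFinM lee_fin mulrC sqr_normal_pdf_le.
exact: mpdf.
Qed.

End normal_second_moment.

Section grid_inequality.
Context d (T : measurableType d) (R : realType) (P : probability T R).
Variables (B : brownian_motion P) (t : R).
Hypothesis t0 : 0 < t.
Local Notation dt n := (t / n.+1%:R).
Local Notation grid n := (bm_grid B (dt n) n.+1).

Let dt0 n : 0 < dt n. Proof. by rewrite divr_gt0. Qed.

Definition bm_centered (w : T) (s : R) : R := B s w - B 0 w.

Lemma bm_centered_continuous w : {within `[0, t], continuous (bm_centered w)}.
Proof.
have sub : `[0, t] `<=` (`[0, +oo[ : set R).
  by move=> s /=; rewrite !in_itv/= => /andP[->].
have cB := continuous_subspaceW sub (@bm_continuous d T R P B w).
apply: (@within_continuous_comp _ _ _ _ (fun s => B s w) (fun x : R => x - B 0 w)).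
  by move=> x _; apply: cvgB; [exact: cvg_id|exact: cvg_cst].
exact: cB.
Qed.

Lemma bm_centered0 w : bm_centered w 0 = 0.
Proof. exact: subrr. Qed.

Lemma bm_grid_ygrid n w : grid n w = ygrid t (bm_centered w) n.
Proof. by []. Qed.

Lemma measurable_bm_grid_seq m h : 0 < h -> measurable_fun setT (bm_grid B h m).
Proof.
move=> h0; apply: measurable_rseqP => i; rewrite /bm_grid.
case: (i < m)%N => //; apply: measurable_funB; apply: bm_measurable => //.
by rewrite mulr_ge0// ltW.
Qed.

Lemma integral_quad_var_le n :
  (\int[P]_w (quad_var n.+1 (grid n w))%:E <= (8 * t)%:E)%E.
Proof.
have mb (i : nat) : measurable_fun setT (fun w => (binc B (dt n) i w ^+ 2)%:E).
  apply/measurable_EFinP; apply: measurable_funX.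
  exact: measurable_binc.
have -> : (fun w => (quad_var n.+1 (grid n w))%:E) =
    (fun w => \sum_(i < n.+1) (binc B (dt n) i w ^+ 2)%:E)%E.
  apply/funext => w; rewrite sumEFin; congr EFin; apply: eq_bigr => -[i ni] _ /=.
  congr (_ ^+ 2); rewrite /step /= /bm_grid ni.
  by case: i ni => [|i] ni /=; rewrite /binc ?mul0r ?subr0// (ltnW ni) opprB addrA subrK.
rewrite ge0_integral_sum//; last by move=> i w _; rewrite lee_fin sqr_ge0.
apply: (@le_trans _ _ (\sum_(i < n.+1) (8 * dt n)%:E)%E); last first.
  rewrite sumEFin lee_fin sumr_const card_ord -[leLHS]mulr_natl.
  by rewrite [n.+1%:R * _]mulrC -mulrA divfK ?pnatr_eq0.
apply: lee_sum => i _.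
have mbi : measurable_fun setT (binc B (dt n) i : T -> measurableTypeR R).
  exact: measurable_binc.
have msq : measurable_fun setT (fun x : measurableTypeR R => (x ^+ 2)%:E).
  by apply/measurable_EFinP; exact: measurable_funX.
have sq0 (x : measurableTypeR R) : (0 <= (x ^+ 2)%:E)%E by rewrite lee_fin sqr_ge0.
have c0 (w : T) : 0 <= cst (1 : R) w by [].
have e := ge0_integral_wpush P mbi (measurable_cst _) c0 msq sq0.
rewrite (_ : \int[P]_x _ = \int[P]_x (1%:E * (binc B (dt n) i x ^+ 2)%:E))%E; last first.
  by apply: eq_integral => w _; rewrite mul1e.
rewrite -e; apply: (le_trans _ (normal_second_moment_le (dt0 n))).
rewrite le_eqVlt; apply/orP; left; apply/eqP.
apply: eq_measure_integral => A mA _.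
have mbA : measurable (binc B (dt n) i @^-1` A).
  by have := mbi measurableT _ mA; rewrite setTI.
by rewrite wpushE (integral_cst P mbA 1%E) mul1e; exact: binc_law.
Qed.

End grid_inequality.

Section limit_inequality.
Context d (T : measurableType d) (R : realType) (P : probability T R).
Variables (B : brownian_motion P) (t : R).
Hypothesis t0 : 0 < t.
Local Notation dt n := (t / n.+1%:R).
Local Notation grid n := (bm_grid B (dt n) n.+1).

Let dt0 n : 0 < dt n. Proof. by rewrite divr_gt0. Qed.

Lemma cvg_minr_cst (u : nat -> R) (l K : R) :
  u n @[n --> \oo] --> l -> Num.min (u n) K @[n --> \oo] --> Num.min l K.
Proof.
move=> ul; under eq_fun do rewrite minr_absE; rewrite minr_absE.
apply: cvgMr_tmp; apply: cvgB; first exact: (cvgD ul (cvg_cst _)).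
by apply: cvg_norm; exact: (cvgB ul (cvg_cst _)).
Qed.

(* The last term, linear in [Q], avoids any almost sure convergence of the quadratic
   variation. *)
Lemma expR_trunc_le (m X Q r K L : R) : 0 < L -> 0 <= X -> 0 <= Q -> 0 <= K ->
  m - X * Q <= r ->
  Num.min (expR m) K * expR (- (X * L)) <= expR r + K / L * Q.
Proof.
move=> L0 X0 Q0 K0 mr; set k := Num.min _ _.
have k0 : 0 <= k by rewrite le_min expR_ge0.
have kK : k <= K by rewrite ge_min lexx orbT.
have km : k <= expR m by rewrite ge_min lexx.
have KLQ : 0 <= K / L * Q by rewrite !mulr_ge0// invr_ge0 ltW.
have [QL|LQ] := leP Q L.
  apply: (@le_trans _ _ (expR r)); last by rewrite lerDl.
  apply: (le_trans _ (_ : expR (m - X * Q) <= _)); last by rewrite ler_expR.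
  rewrite expRD; apply: ler_pM; rewrite ?expR_ge0//.
  by rewrite ler_expR lerN2 ler_wpM2l.
apply: (@le_trans _ _ K).
  rewrite -[leRHS]mulr1; apply: ler_pM; rewrite ?expR_ge0//.
  by rewrite -expR0 ler_expR oppr_le0 mulr_ge0// ltW.
apply: (@le_trans _ _ (K / L * Q)); last by rewrite lerDr expR_ge0.
by rewrite -mulrA ler_peMr// mulrC ler_pdivlMr// mul1r ltW.
Qed.

Variables (z : R) (H : nat -> rseq R -> R) (h1 h2 : T -> R).
Hypothesis mH : forall n, measurable_fun setT (H n).
Hypothesis H01 : forall n y, 0 <= H n y <= 1.
Hypothesis Hh1 : forall w, H n (grid n w) @[n --> \oo] --> h1 w.
Hypothesis Hh2 : forall w, H n (gT (dt n) n.+1 z (grid n w)) @[n --> \oo] --> h2 w.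

Local Notation ld w := (log_density t z (bm_centered B w)).

(** [H] may depend on the mesh: it will be a cylinder functional read on the grid, its composition
    with [gT], or such a functional times a truncated inverse density. *)
Lemma limit_inequality (K : R) : 0 <= K ->
  (\int[P]_w (Num.min (expR (ld w)) K * h1 w)%:E <= \int[P]_w (h2 w)%:E)%E.
Proof.
move=> K0; apply/lee_addgt0Pr => e e0.
(* Chosen so that [K / L] times the bound [8 * t] on the mean of [Q] is at most [e]; the added 1
   keeps [L] positive. *)
pose L := K * (8 * t) / e + 1.
have L0 : 0 < L by rewrite ltr_wpDl// divr_ge0 ?(ltW e0)// mulr_ge0// mulr_ge0// ltW.
have mg n := measurable_bm_grid_seq B n.+1 (dt0 n).
have n1 n : (0 < n.+1)%N by [].
pose a n w := Num.min (expR (log_main (dt n) n.+1 z (grid n w))) K *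
  expR (- (max_drift (dt n) n.+1 (- z) (grid n w) * L)) * H n (grid n w).
have ma n : measurable_fun setT (a n).
  apply: measurable_funM; last exact: (measurableT_comp (mH n) (mg n)).
  apply: measurable_funM.
    apply: measurable_minr; last exact: measurable_cst.
    apply: measurableT_comp => //.
    exact: (measurableT_comp (measurable_log_main (dt0 n) (n1 n) z) (mg n)).
  apply: measurableT_comp => //; apply: measurable_funN.
  apply: measurable_funM; last exact: measurable_cst.
  exact: (measurableT_comp (measurable_max_drift n.+1 (dt0 n) (- z)) (mg n)).
have min0 (x : R) : 0 <= Num.min (expR x) K by rewrite le_min expR_ge0.
have minK (x : R) : Num.min (expR x) K <= K by rewrite ge_min lexx orbT.
have aK n w : 0 <= a n w <= K.
  have /andP[H0 H1] := H01 n (grid n w).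
  rewrite !mulr_ge0 ?min0 ?expR_ge0//= -[leRHS]mulr1.
  apply: ler_pM => //; first by rewrite mulr_ge0 ?min0 ?expR_ge0.
  rewrite -[leRHS]mulr1; apply: ler_pM; rewrite ?min0 ?expR_ge0 ?minK//.
  by rewrite -expR0 ler_expR oppr_le0 mulr_ge0 ?max_drift_ge0// ltW.
have acvg w : a n w @[n --> \oo] --> Num.min (expR (ld w)) K * h1 w.
  have cw : {within `[0, t], continuous (bm_centered B w)}.
    exact: bm_centered_continuous.
  have w0 := bm_centered0 B w.
  rewrite -[Num.min _ _]mulr1; apply: cvgM; last exact: Hh1.
  apply: cvgM.
    apply: cvg_minr_cst.
    apply: (cvg_comp _ (@expR R)); last exact: continuous_expR.
    under eq_fun do rewrite bm_grid_ygrid.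
    exact: (log_main_cvg t0 cw w0).
  have md : max_drift (dt n) n.+1 (- z) (grid n w) @[n --> \oo] --> (0 : R).
    under eq_fun do rewrite bm_grid_ygrid.
    exact: (max_drift_cvg t0 cw w0).
  suff : expR (- (max_drift (dt n) n.+1 (- z) (grid n w) * L)) @[n --> \oo]
      --> expR (- (0 * L)) by rewrite mul0r oppr0 expR0.
  apply: (cvg_comp _ (@expR R)); last exact: continuous_expR.
  by apply: cvgN; apply: cvgM; [exact: md|exact: cvg_cst].
have [_ acv] := cvg_integral_bounded P ma aK acvg.
pose b n w := H n (gT (dt n) n.+1 z (grid n w)).
have mb n : measurable_fun setT (b n).
  exact: (measurableT_comp (measurableT_comp (mH n)
    (measurable_gT (dt0 n) n.+1 z)) (mg n)).
have b01 n w : 0 <= b n w <= 1 by exact: H01.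
have [_ bcv] := cvg_integral_bounded P mb b01 Hh2.
have KL : K / L * (8 * t) <= e.
  rewrite mulrAC ler_pdivrMr// /L mulrDr mulr1 [X in _ <= X + _]mulrC divfK ?gt_eqF//.
  by rewrite lerDl ltW.
have ab n : (\int[P]_w (a n w)%:E <= \int[P]_w (b n w)%:E + e%:E)%E.
  pose G y := (H n y)%:E.
  have mG : measurable_fun setT G by exact/measurable_EFinP.
  have G0 y : (0 <= G y)%E by rewrite lee_fin; have /andP[] := H01 n y.
  have bE := integral_gT_bm_grid B (dt0 n) n z mG G0.
  rewrite [X in (_ <= X + _)%E]bE.
  have mD : measurable_fun setT (fun w =>
      (G (grid n w) * (expR (log_ratio (dt n) n.+1 z (grid n w)))%:E)%E).
    apply: emeasurable_funM; first exact: (measurableT_comp mG (mg n)).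
    apply/measurable_EFinP; apply: measurableT_comp => //.
    exact: (measurableT_comp (measurable_log_ratio (dt0 n) n.+1 z) (mg n)).
  have mQ : measurable_fun setT (fun w => (quad_var n.+1 (grid n w))%:E).
    apply/measurable_EFinP.
    exact: (measurableT_comp (measurable_quad_var n.+1) (mg n)).
  have Q0 w : 0 <= quad_var n.+1 (grid n w).
    by apply: sumr_ge0 => i _; exact: sqr_ge0.
  have KL0 : 0 <= K / L by rewrite divr_ge0// ltW.
  apply: (@le_trans _ _ (\int[P]_w
      (G (grid n w) * (expR (log_ratio (dt n) n.+1 z (grid n w)))%:E +
       (K / L)%:E * (quad_var n.+1 (grid n w))%:E))%E).
    apply: ge0_le_integral => //.
    - by move=> w _; rewrite lee_fin; have /andP[] := aK n w.
    - exact/measurable_EFinP.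
    - by apply: emeasurable_funD => //; exact: measurable_funeM.
    - move=> w _; rewrite -!EFinM -EFinD lee_fin /a.
      have /andP[H0 H1] := H01 n (grid n w).
      have := expR_trunc_le L0 (max_drift_ge0 _ _ _ _) (Q0 w) K0
        (log_ratio_ge (dt0 n) (n1 n) z (grid n w)).
      move=> /(ler_wpM2r H0)/le_trans; apply.
      rewrite mulrDl [X in X + _]mulrC lerD2l ler_piMr//.
      by rewrite mulr_ge0.
  rewrite ge0_integralD//; last 3 first.
  - by move=> w _; rewrite mule_ge0// lee_fin expR_ge0.
  - by move=> w _; rewrite mule_ge0// lee_fin.
  - exact: measurable_funeM.
  apply: leeD2l; rewrite ge0_integralZl//; last by move=> w _; rewrite lee_fin; exact: Q0.
  apply: (@le_trans _ _ ((K / L)%:E * (8 * t)%:E)%E).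
    by apply: lee_wpmul2l; [rewrite lee_fin|exact: integral_quad_var_le].
  by rewrite -EFinM lee_fin.
have becv : (\int[P]_w (b n w)%:E + e%:E)%E @[n --> \oo] -->
    (\int[P]_w (h2 w)%:E + e%:E)%E.
  apply: cvgeD => //; last exact: cvg_cst.
  by rewrite fin_num_adde_defl.
have ab' : \forall n \near \oo,
    (\int[P]_w (a n w)%:E <= \int[P]_w (b n w)%:E + e%:E)%E.
  by apply: nearW => n; exact: ab.
have := lee_lim (cvgP _ acv) (cvgP _ becv) ab'.
by rewrite (cvg_lim _ acv)// (cvg_lim _ becv)//; apply; exact: _.
Qed.

End limit_inequality.

(** * Cylinder functionals with continuous factors *)

Definition ramp {R : realType} (m : nat) (x : R) : R :=
  Num.min (Num.max 0 (m%:R * x)) 1.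

(** Continuous in finitely many path values, hence compatible with the mesh limit, and increasing in
    [m] to the indicator of the constraints [f p.1 < p.2]. *)
Definition cyl {R : realType} (m : nat) (l : seq (R * R)) (f : R -> R) : R :=
  \prod_(p <- l) ramp m (p.2 - f p.1).

Section ramp.
Context {R : realType}.
Implicit Types (l : seq (R * R)) (m : nat).

Lemma ramp01 m (x : R) : 0 <= ramp m x <= 1.
Proof. by rewrite /ramp le_min ler01 le_max lexx ge_min lexx orbT. Qed.

Lemma ramp_continuous m : continuous (@ramp R m).
Proof.
move=> x; apply: (@continuous_min _ R (fun x => Num.max 0 (m%:R * x)) (cst 1));
  last exact: cst_continuous.
apply: (@continuous_max _ R (cst 0) (fun x => m%:R * x)).
  exact: cst_continuous.
exact: mulrl_continuous.
Qed.

Lemma measurable_ramp m : measurable_fun setT (@ramp R m).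
Proof. by apply: continuous_measurable_fun; exact: ramp_continuous. Qed.

Lemma cyl01 m l f : 0 <= cyl m l f <= 1.
Proof.
rewrite /cyl; elim: l => [|p l IH]; first by rewrite big_nil ler01 lexx.
rewrite big_cons; case/andP: IH => c0 c1; case/andP: (ramp01 m (p.2 - f p.1)) => r0 r1.
by rewrite mulr_ge0//= -[leRHS]mulr1 ler_pM.
Qed.

Lemma cyl_cvg m l (u : nat -> R -> R) (f : R -> R) :
  (forall p, p \in l -> u n p.1 @[n --> \oo] --> f p.1) ->
  cyl m l (u n) @[n --> \oo] --> cyl m l f.
Proof.
rewrite /cyl; elim: l => [|p l IH] h.
  under eq_fun do rewrite big_nil; rewrite big_nil; exact: cvg_cst.
under eq_fun do rewrite big_cons; rewrite big_cons.
apply: cvgM; last by apply: IH => q ql; apply: h; rewrite inE ql orbT.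
apply: (cvg_comp _ (@ramp R m)); last exact: ramp_continuous.
by apply: cvgB; [exact: cvg_cst|apply: h; rewrite inE eqxx].
Qed.

Lemma measurable_cyl d (T : measurableType d) m l (u : R -> T -> R) :
  (forall s, measurable_fun setT (u s)) ->
  measurable_fun setT (fun w => cyl m l (u ^~ w)).
Proof.
move=> mu; rewrite /cyl; elim: l => [|p l IH].
  by under eq_fun do rewrite big_nil; exact: measurable_cst.
under eq_fun do rewrite big_cons; apply: measurable_funM => //.
apply: (measurableT_comp (measurable_ramp m)).
exact: measurable_funB.
Qed.

End ramp.

Section limit_identity.
Context d (T : measurableType d) (R : realType) (P : probability T R).
Variables (B : brownian_motion P) (t : R).
Hypothesis t0 : 0 < t.
Local Notation dt n := (t / n.+1%:R).
Local Notation grid n := (bm_grid B (dt n) n.+1).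

Let dt0 n : 0 < dt n. Proof. by rewrite divr_gt0. Qed.
Let n1 n : (0 < n.+1)%N. Proof. by []. Qed.

Let cw w : {within `[0, t], continuous (bm_centered B w)}.
Proof. exact: bm_centered_continuous. Qed.

Let w0 w := bm_centered0 B w.

Let log_main_grid_cvg z w : log_main (dt n) n.+1 z (grid n w) @[n --> \oo] -->
  log_density t z (bm_centered B w).
Proof.
under eq_fun do rewrite bm_grid_ygrid.
exact: (log_main_cvg t0 (@cw w) (w0 w)).
Qed.

Let mgrid n : measurable_fun setT (grid n).
Proof. exact: measurable_bm_grid_seq. Qed.

Lemma measurable_log_density z :
  measurable_fun setT (fun w => log_density t z (bm_centered B w)).
Proof.
apply: (measurable_fun_cvg (h := fun n w => log_main (dt n) n.+1 z (grid n w))).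
  move=> n; exact: (measurableT_comp (measurable_log_main (dt0 n) (n1 n) z) (mgrid n)).
by move=> w _; exact: log_main_grid_cvg.
Qed.

Let ED z w := expR (log_density t z (bm_centered B w)).

Let ED0 z w : 0 <= ED z w. Proof. exact: expR_ge0. Qed.
Let mED z : measurable_fun setT (ED z).
Proof. by apply: measurableT_comp => //; exact: measurable_log_density. Qed.

Variables (z : R) (H : nat -> rseq R -> R) (X Y : T -> R).
Hypothesis mH : forall n, measurable_fun setT (H n).
Hypothesis H01 : forall n y, 0 <= H n y <= 1.
Hypothesis HX : forall w, H n (grid n w) @[n --> \oo] --> X w.
Hypothesis HY : forall w, H n (gT (dt n) n.+1 z (grid n w)) @[n --> \oo] --> Y w.

Let X01 w : 0 <= X w <= 1.
Proof.
rewrite -(cvg_lim _ (@HX w))//; apply/andP; split.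
  apply: limr_ge; first exact: cvgP (@HX w).
  by apply: nearW => n; have /andP[] := H01 n (grid n w).
apply: limr_le; first exact: cvgP (@HX w).
by apply: nearW => n; have /andP[] := H01 n (grid n w).
Qed.

Let Y01 w : 0 <= Y w <= 1.
Proof.
rewrite -(cvg_lim _ (@HY w))//; apply/andP; split.
  apply: limr_ge; first exact: cvgP (@HY w).
  by apply: nearW => n; have /andP[] := H01 n (gT (dt n) n.+1 z (grid n w)).
apply: limr_le; first exact: cvgP (@HY w).
by apply: nearW => n; have /andP[] := H01 n (gT (dt n) n.+1 z (grid n w)).
Qed.

Let X0 w : 0 <= X w. Proof. by have /andP[] := X01 w. Qed.

Lemma measurable_grid_limit : measurable_fun setT X.
Proof.
apply: (measurable_fun_cvg (h := fun n w => H n (grid n w))).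
  by move=> n; exact: (measurableT_comp (mH n) (mgrid n)).
by move=> w _; exact: HX.
Qed.

Lemma measurable_gT_grid_limit : measurable_fun setT Y.
Proof.
apply: (measurable_fun_cvg (h := fun n w => H n (gT (dt n) n.+1 z (grid n w)))).
  move=> n; exact: (measurableT_comp (measurableT_comp (mH n)
    (measurable_gT (dt0 n) n.+1 z)) (mgrid n)).
by move=> w _; exact: HY.
Qed.

Let mX := measurable_grid_limit.
Let mY := measurable_gT_grid_limit.

Let limit_le : (\int[P]_w (ED z w * X w)%:E <= \int[P]_w (Y w)%:E)%E.
Proof.
pose u (k : nat) w := (Num.min (ED z w) k%:R * X w)%:E.
have mu k : measurable_fun setT (u k).
  apply/measurable_EFinP; apply: measurable_funM => //.
  by apply: measurable_minr => //; exact: mED.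
have u0 k w : [set: T] w -> (0 <= u k w)%E.
  by move=> _; rewrite lee_fin mulr_ge0// le_min ED0 ler0n.
have und w : [set: T] w -> {homo u ^~ w : a b / (a <= b)%N >-> (a <= b)%E}.
  move=> _ a b ab; rewrite lee_fin ler_wpM2r// le_min ge_min lexx/=.
  by rewrite ge_min ler_nat ab orbT.
have ucv := cvg_monotone_convergence (mu := P) measurableT mu u0 und.
rewrite (_ : (\int[P]_w (ED z w * X w)%:E)%E =
    (\int[P]_w limn (u ^~ w))%E); last first.
  apply: eq_integral => w _; apply/esym/cvg_lim => //.
  apply: cvg_EFin; first exact: nearW.
  apply: cvgMr_tmp; apply: cvg_near_cst.
  near=> k; apply/min_idPl.
  near: k; exact: nbhs_infty_ger.
rewrite -(cvg_lim _ ucv)//; apply: lime_le; first exact: cvgP ucv.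
apply: nearW => k.
exact: (limit_inequality t0 mH H01 HX HY).
Unshelve. all: by end_near. Qed.

(* [limit_inequality] for [- z], applied to [H o gT z] times a truncation of the
   inverse density. *)
Let limit_ge : (\int[P]_w (Y w)%:E <= \int[P]_w (ED z w * X w)%:E)%E.
Proof.
(* Dividing by [k.+1] and capping at 1 keeps the weight in [[0, 1]], as [limit_inequality] demands;
   [v] below restores the factor [k.+1]. *)
pose HK (k n : nat) (y : rseq R) := H n (gT (dt n) n.+1 z y) *
  Num.min (expR (- log_main (dt n) n.+1 (- z) y) / k.+1%:R) 1.
have min01 (x : R) (k : nat) : 0 <= Num.min (expR x / k.+1%:R) 1 <= 1.
  by rewrite le_min ler01 divr_ge0 ?expR_ge0// ge_min lexx orbT.
have mHK k n : measurable_fun setT (HK k n).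
  apply: measurable_funM.
    exact: (measurableT_comp (mH n) (measurable_gT (dt0 n) n.+1 z)).
  apply: measurable_minr; last exact: measurable_cst.
  apply: measurable_funM; last exact: measurable_cst.
  apply: measurableT_comp => //; apply: measurable_funN.
  exact: measurable_log_main.
have HK01 k n y : 0 <= HK k n y <= 1.
  have /andP[c0 c1] := H01 n (gT (dt n) n.+1 z y).
  have /andP[m0 m1] := min01 (- log_main (dt n) n.+1 (- z) y) k.
  by rewrite mulr_ge0//= -[leRHS]mulr1 ler_pM.
have cvg_min1 (u : nat -> R) (x : R) (k : nat) : u n @[n --> \oo] --> x ->
    Num.min (expR (u n) / k.+1%:R) 1 @[n --> \oo] --> Num.min (expR x / k.+1%:R) 1.
  move=> ux; apply: cvg_minr_cst; apply: cvgMr_tmp.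
  by apply: (cvg_comp _ (@expR R)); [exact: ux|exact: continuous_expR].
pose h1 k w := Y w * Num.min ((ED (- z) w)^-1 / k.+1%:R) 1.
pose h2 k w := X w * Num.min (ED z w / k.+1%:R) 1.
have Hh1 k w : HK k n (grid n w) @[n --> \oo] --> h1 k w.
  apply: cvgM; first exact: HY.
  rewrite /ED -expRN; apply: cvg_min1; apply: cvgN.
  exact: log_main_grid_cvg.
(* [gT (- z)] undoes the inner [gT z]. It keeps [gZ] and adds [z] to the endpoint, so
   [- log_main (- z)] becomes [log_main z]. *)
have Hh2 k w : HK k n (gT (dt n) n.+1 (- z) (grid n w)) @[n --> \oo] --> h2 k w.
  rewrite (_ : (fun n => _) = (fun n => H n (grid n w) *
      Num.min (expR (log_main (dt n) n.+1 z (grid n w)) / k.+1%:R) 1)).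
    apply: cvgM; first exact: HX.
    by apply: cvg_min1; exact: log_main_grid_cvg.
  apply/funext => n; rewrite /HK; congr (H n _ * Num.min (expR _ / _) 1).
    by have := gTK (dt0 n) (n1 n) (- z) (grid n w); rewrite opprK.
  by rewrite /log_main gZ_gT// gpath_gTn// opprK -mulNr opprB addrK.
(* The density and its inverse are capped separately: their product is at most 1, and it equals 1
   once [k] exceeds both. *)
pose v k w := Num.min (ED (- z) w) k.+1%:R * Num.min ((ED (- z) w)^-1) k.+1%:R * Y w.
have vE k w : v k w = k.+1%:R * (Num.min (ED (- z) w) k.+1%:R * h1 k w).
  have e : k.+1%:R * Num.min ((ED (- z) w)^-1 / k.+1%:R) 1 =
      Num.min ((ED (- z) w)^-1) k.+1%:R.
    by rewrite minr_pMr ?ler0n// mulr1 mulrC divfK// pnatr_eq0.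
  by rewrite /v /h1 -e; ring.
have mv k : measurable_fun setT (v k).
  apply: measurable_funM => //; apply: measurable_funM; apply: measurable_minr => //.
  by apply: measurable_funVr; [move=> w; exact: expR_gt0|exact: mED].
have v01 k w : 0 <= v k w <= 1.
  have /andP[c0 c1] := Y01 w.
  have E0 := expR_gt0 (log_density t (- z) (bm_centered B w)).
  rewrite !mulr_ge0 ?le_min ?invr_ge0 ?ler0n ?ED0//=.
  rewrite -[leRHS]mulr1 ler_pM// ?mulr_ge0 ?le_min ?invr_ge0 ?ler0n ?ED0//.
  rewrite -[leRHS](@divff _ (ED (- z) w)) ?gt_eqF//.
  by rewrite ler_pM ?le_min ?invr_ge0 ?ler0n ?ED0// ge_min lexx.
have vcv w : v k w @[k --> \oo] --> Y w.
  apply: cvg_near_cst; near=> k; rewrite /v.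
  have /min_idPl -> : ED (- z) w <= k.+1%:R.
    by near: k; apply: filterS (nbhs_infty_ger (ED (- z) w)) => k /le_trans; apply; rewrite ler_nat.
  have /min_idPl -> : (ED (- z) w)^-1 <= k.+1%:R.
    by near: k; apply: filterS (nbhs_infty_ger ((ED (- z) w)^-1)) => k /le_trans; apply; rewrite ler_nat.
  by rewrite divff ?mul1r// gt_eqF// expR_gt0.
have [_ vcvg] := cvg_integral_bounded P mv v01 vcv.
rewrite -(cvg_lim _ vcvg)//; apply: lime_le; first exact: cvgP vcvg.
apply: nearW => k.
have k0 : 0 <= k.+1%:R :> R by rewrite ler0n.
have ineq := limit_inequality t0 (mHK k) (HK01 k) (Hh1 k) (Hh2 k) k0.
have h10 w : 0 <= h1 k w.
  have /andP[c0 _] := Y01 w.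
  by rewrite mulr_ge0// le_min ler01 divr_ge0// invr_ge0.
have h20 w : 0 <= h2 k w.
  by rewrite mulr_ge0// le_min ler01 divr_ge0.
have mh1 : measurable_fun setT (h1 k).
  apply: measurable_funM => //; apply: measurable_minr => //.
  apply: measurable_funM => //.
  by apply: measurable_funVr; [move=> w; exact: expR_gt0|exact: mED].
have mh2 : measurable_fun setT (h2 k).
  apply: measurable_funM => //; apply: measurable_minr => //.
  exact: measurable_funM.
have vint : (\int[P]_w (v k w)%:E =
    k.+1%:R%:E * \int[P]_w (Num.min (ED (- z) w) k.+1%:R * h1 k w)%:E)%E.
  rewrite -ge0_integralZl//.
  - by apply: eq_integral => w _; rewrite vE EFinM.
  - apply/measurable_EFinP; apply: measurable_funM => //.
    by apply: measurable_minr => //; exact: mED.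
  - by move=> w _; rewrite lee_fin mulr_ge0// le_min ED0.
rewrite vint; apply: (@le_trans _ _ (k.+1%:R%:E * \int[P]_w (h2 k w)%:E)%E).
  by apply: lee_wpmul2l; [rewrite lee_fin|exact: ineq].
rewrite -ge0_integralZl//.
- apply: ge0_le_integral => //.
  + by move=> w _; rewrite mule_ge0// lee_fin.
  + by apply: measurable_funeM; exact/measurable_EFinP.
  + by apply/measurable_EFinP; apply: measurable_funM => //; exact: mED.
  + move=> w _; rewrite -EFinM lee_fin /h2 mulrCA [leRHS]mulrC.
    apply: ler_wpM2l => //; rewrite minr_pMr ?ler0n// mulrC divfK ?pnatr_eq0//.
    by rewrite ge_min lexx.
- exact/measurable_EFinP.
- by move=> w _; rewrite lee_fin.
Unshelve. all: by end_near. Qed.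

Lemma limit_identity :
  (\int[P]_w (Y w)%:E =
   \int[P]_w (expR (log_density t z (bm_centered B w)) * X w)%:E)%E.
Proof. by apply/eqP; rewrite eq_le limit_ge limit_le. Qed.

End limit_identity.

Section cylinder_identity.
Context d (T : measurableType d) (R : realType) (P : probability T R).
Variables (B : brownian_motion P) (t : R).
Hypothesis t0 : 0 < t.
Local Notation dt n := (t / n.+1%:R).
Local Notation grid n := (bm_grid B (dt n) n.+1).

Let dt0 n : 0 < dt n. Proof. by rewrite divr_gt0. Qed.

Variables (m : nat) (l : seq (R * R)).
Hypothesis lt : forall p, p \in l -> 0 <= p.1 <= t.

Let gcyl n (y : rseq R) := cyl m l (fun s => gpath y (grid_index t n s)).

Let mgcyl n : measurable_fun setT (gcyl n).
Proof. by apply: measurable_cyl => s; exact: measurable_gpath. Qed.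

Let gcyl01 n y : 0 <= gcyl n y <= 1. Proof. exact: cyl01. Qed.

Let cw w : {within `[0, t], continuous (bm_centered B w)}.
Proof. exact: bm_centered_continuous. Qed.

Let w0 w := bm_centered0 B w.

Let gcyl_cvg w : gcyl n (grid n w) @[n --> \oo] --> cyl m l (bm_centered B w).
Proof.
under eq_fun do rewrite bm_grid_ygrid.
by apply: cyl_cvg => p /lt pt; exact: (gpath_index_cvg t0 (@cw w) (w0 w) pt).
Qed.

Let gcyl_gT_cvg z w : gcyl n (gT (dt n) n.+1 z (grid n w)) @[n --> \oo] -->
  cyl m l (transf t z (bm_centered B w)).
Proof.
under eq_fun do rewrite bm_grid_ygrid.
by apply: cyl_cvg => p /lt pt; exact: (gT_index_cvg t0 (@cw w) (w0 w) pt).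
Qed.

Lemma measurable_cyl_centered :
  measurable_fun setT (fun w => cyl m l (bm_centered B w)).
Proof. exact: (measurable_grid_limit t0 mgcyl gcyl_cvg). Qed.

Lemma measurable_cyl_transf z :
  measurable_fun setT (fun w => cyl m l (transf t z (bm_centered B w))).
Proof. exact: (measurable_gT_grid_limit t0 mgcyl (@gcyl_gT_cvg z)). Qed.

Lemma cylinder_identity z :
  (\int[P]_w (cyl m l (transf t z (bm_centered B w)))%:E =
   \int[P]_w (expR (log_density t z (bm_centered B w)) *
               cyl m l (bm_centered B w))%:E)%E.
Proof. exact: (limit_identity t0 mgcyl gcyl01 gcyl_cvg (@gcyl_gT_cvg z)). Qed.

(** The functional is composed with [gT (- z)] on the grid, so the exact discrete inverse [gTK]
    stands in for inverting the transformation on continuous paths. *)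
Lemma cylinder_identity_opp z :
  (\int[P]_w (cyl m l (bm_centered B w))%:E =
   \int[P]_w (expR (log_density t z (bm_centered B w)) *
               cyl m l (transf t (- z) (bm_centered B w)))%:E)%E.
Proof.
pose H n y := gcyl n (gT (dt n) n.+1 (- z) y).
apply: (limit_identity t0 (H := H)).
- move=> n; exact: (measurableT_comp (mgcyl n) (measurable_gT (dt0 n) n.+1 (- z))).
- by move=> n y; exact: gcyl01.
- by move=> w; exact: gcyl_gT_cvg.
- move=> w; rewrite /H; under eq_fun do rewrite gTK//.
  exact: gcyl_cvg.
Qed.

End cylinder_identity.

(** * The Borel sets of the path space *)

Section cpath_borel.
Context {R : realType} (t : R).

Lemma cpath_fun_val (phi : cpath t) (s : set_type `[0, t]) :
  cpath_fun phi (set_val s) = (phi : continuousType _ _) s.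
Proof.
exact: (congr1 (fun g => g s) (valLK 0 (phi : continuousType _ _))).
Qed.

Lemma open_cpath_ball (U : set (cpath t)) (phi : cpath t) : open U -> U phi ->
  exists2 e : R, 0 < e & forall psi : cpath t,
    (forall s, 0 <= s <= t -> `|cpath_fun phi s - cpath_fun psi s| < e) -> U psi.
Proof.
move=> oU Uphi.
have : nbhs phi U by exact: open_nbhs_nbhs.
rewrite -nbhs_entourageE => -[E entE EU].
case: entE => E1 [A entA AE1] E1E.
move: entA; rewrite -entourage_ballE => -[e /= e0 eA].
exists e => // psi h; apply: EU; rewrite /xsection /= inE; apply: E1E => /=; apply: AE1 => s /=.
apply: eA; rewrite /= /ball /=.
have := h (set_val s); rewrite !cpath_fun_val; apply.
by have := set_valP s; rewrite /= in_itv.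
Qed.

Lemma cpath_eval_open (s a : R) : 0 <= s <= t ->
  open [set phi : cpath t | cpath_fun phi s < a].
Proof.
move=> st; rewrite openE => phi /= phia.
have sI : s \in [set` `[0, t]] by rewrite inE /= in_itv.
pose s' : set_type [set` `[0, t]] := SigSub sI.
rewrite /interior -nbhs_entourageE.
pose e := a - cpath_fun phi s; have e0 : 0 < e by rewrite subr_gt0.
exists [set fg : cpath t * cpath t | `|cpath_fun fg.1 s - cpath_fun fg.2 s| < e].
  exists [set fg | forall u, ball (fg.1 u) e (fg.2 u)].
    by exists [set xy | ball xy.1 e xy.2] => //; rewrite -entourage_ballE; exists e.
  move=> [f g] /= /(_ s'); rewrite /ball /=.
  by rewrite -!cpath_fun_val.
move=> psi; rewrite /xsection /= inE /= /e distrC => /(le_lt_trans (ler_norm _)).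
by rewrite ltrD2r.
Qed.

(** A list may repeat a time, so concatenation of lists gives closure under intersection. *)
Definition cpath_cylinder : set (set (cpath t)) :=
  [set E | exists2 l : seq (R * R), (forall p, p \in l -> 0 <= p.1 <= t) &
    E = [set phi | forall p, p \in l -> cpath_fun phi p.1 < p.2]].

Lemma cpath_cylinder_setI : setI_closed cpath_cylinder.
Proof.
move=> _ _ [k kt ->] [l lt ->]; exists (k ++ l).
  by move=> p; rewrite mem_cat => /orP[/kt|/lt].
apply/seteqP; split => phi /=.
  by move=> [hk hl] p; rewrite mem_cat => /orP[/hk|/hl].
by move=> h; split => p pin; apply: h; rewrite mem_cat pin ?orbT.
Qed.

Lemma measurable_cpath_eval (s : R) : 0 <= s <= t ->
  measurable_fun [set: g_sigma_algebraType cpath_cylinder]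
    (fun phi : g_sigma_algebraType cpath_cylinder => cpath_fun (phi : cpath t) s).
Proof.
move=> st; apply: (measurability _ (RGenInftyO.measurableE R)).
move=> _ [_ [a ->] <-]; rewrite setTI; apply: sub_sigma_algebra.
exists [:: (s, a)]; first by move=> p; rewrite inE => /eqP ->.
apply/seteqP; split => phi /=; rewrite in_itv/=.
  by move=> h p; rewrite inE => /eqP ->.
by move=> /(_ (s, a)); apply; rewrite inE.
Qed.

Hypothesis t0 : 0 < t.
Local Notation dt n := (t / n.+1%:R).

(* Countably many closed sets, of diameter at most [2 / (k + 1)], that cover the path
   space; every open set is the union of those it contains. *)
Definition near_step (N : nat) (q : seq rat) (k : nat) : set (cpath t) :=
  [set phi | forall n i, (i <= n.+1)%N ->
    `|cpath_fun phi (i%:R * dt n) -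
      ratr (nth 0 q (grid_index t N (i%:R * dt n)))| <= k.+1%:R^-1].

Lemma near_step_measurable N q k : <<s cpath_cylinder >> (near_step N q k).
Proof.
pose M := g_sigma_algebraType cpath_cylinder.
suff : @measurable _ M (near_step N q k) by [].
rewrite (_ : near_step N q k = \bigcap_n \bigcap_(i in [set i | (i <= n.+1)%N])
    [set phi : M | `|cpath_fun (phi : cpath t) (i%:R * dt n) -
      ratr (nth 0 q (grid_index t N (i%:R * dt n)))| <= k.+1%:R^-1]); last first.
  by apply/seteqP; split => phi h n; [move=> _ i; exact: h|move=> i ni; exact: h].
apply: bigcap_measurable => [|n _]; first by exists 0%N.
apply: bigcap_measurable => [|i /= ni]; first by exists 0%N.
have mf : measurable_fun [set: M] (fun phi : M =>
    `|cpath_fun (phi : cpath t) (i%:R * dt n) -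
      ratr (nth 0 q (grid_index t N (i%:R * dt n)))|).
  apply: measurableT_comp => //; apply: measurable_funB => //.
  by apply: measurable_cpath_eval; exact: grid_pt.
have := mf measurableT `]-oo, k.+1%:R^-1]%classic (measurable_itv _).
by rewrite setTI.
Qed.

Lemma near_step_dist N q k (phi psi : cpath t) :
  near_step N q k phi -> near_step N q k psi ->
  forall s, 0 <= s <= t -> `|cpath_fun phi s - cpath_fun psi s| <= 2 / k.+1%:R.
Proof.
move=> hphi hpsi s st.
(* Membership controls the paths only at grid points; since [n] ranges over all meshes, continuity
   extends the bound to every [s]. *)
have cv : `|cpath_fun phi ((grid_index t n s)%:R * dt n) -
    cpath_fun psi ((grid_index t n s)%:R * dt n)| @[n --> \oo] -->
    `|cpath_fun phi s - cpath_fun psi s|.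
  apply: cvg_norm; apply: cvgB; apply: grid_index_cvg => //;
    exact: cpath_fun_continuous.
rewrite -(cvg_lim _ cv)//; apply: limr_le; first exact: cvgP cv.
apply: nearW => n.
have ni := grid_index_le t0 n st.
have h1 := hphi n _ ni; have h2 := hpsi n _ ni.
set c := ratr _ in h1 h2.
set x := cpath_fun phi _ in h1 *; set y := cpath_fun psi _ in h2 *.
have -> : x - y = (x - c) - (y - c) by ring.
apply: (le_trans (ler_normB _ _)).
by rewrite mulrDl mul1r lerD.
Qed.

Lemma near_step_exists (phi : cpath t) k : exists N q, near_step N q k phi.
Proof.
(* Two errors of size [e] add up to [1 / (k + 1)]: the oscillation of the path over a cell of mesh
   [N], and the rational approximation. *)
pose e : R := (2 * k.+1%:R)^-1.
have e0 : 0 < e by rewrite invr_gt0 mulr_gt0.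
have [N _ hN] := unif_continuous_grid (@cpath_fun_continuous R t phi) e0.
have {}hN := hN N (leqnn N).
pose c i := cpath_fun phi (i%:R * dt N).
have hr i : exists r : rat, `|c i - ratr r| <= e.
  have : c i - e < c i by rewrite ltrBlDr ltrDl.
  move=> /rat_in_itvoo[r]; rewrite in_itv/= => /andP[r1 r2].
  by exists r; rewrite ger0_norm ?subr_ge0 ?ltW//; lra.
pose r i := projT1 (cid (hr i)).
(* The indices of grid [N] run from 0 to [N.+1] inclusive, hence the length. *)
exists N, (mkseq r N.+2) => n i ni.
have st := grid_pt t0 ni.
rewrite nth_mkseq; last by rewrite ltnS grid_index_le.
set s := i%:R * dt n in st *; set j := grid_index t N s.
have jt : 0 <= j%:R * dt N <= t by apply: grid_pt => //; exact: grid_index_le.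
have h1 := hN s _ st jt (grid_index_dist t0 N st).
have h2 : `|c j - ratr (r j)| <= e by rewrite /r; case: cid.
have -> : cpath_fun phi s - ratr (r j) =
  (cpath_fun phi s - cpath_fun phi (j%:R * dt N)) + (c j - ratr (r j)).
  by rewrite /c; ring.
apply: (le_trans (ler_normD _ _)); apply: (le_trans (lerD h1 h2)).
by rewrite /e invfM -mulrDl -[X in X + X]mul1r -mulrDl divff ?mul1r.
Qed.

Lemma open_cpath_cylinder (U : set (cpath t)) : open U ->
  <<s cpath_cylinder >> U.
Proof.
move=> oU; pose M := g_sigma_algebraType cpath_cylinder.
suff : @measurable _ M U by [].
pose V (p : nat * seq rat * nat) := near_step p.1.1 p.1.2 p.2.
pose W (n : nat) : set M := if unpickle n is Some p then
  (if `[< V p `<=` U >] then V p else set0) else set0.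
rewrite (_ : U = \bigcup_n W n).
  apply: bigcupT_measurable => n; rewrite /W; case: unpickle => // p.
  by case: ifP => // _; exact: near_step_measurable.
apply/seteqP; split => phi.
  move=> Uphi; have [e e0 he] := open_cpath_ball oU Uphi.
  have [k] : exists k : nat, 2 / k.+1%:R < e.
    have [k _ hk] := grid_step_lt 2 e0.
    by exists k; exact: (hk k (leqnn k)).
  move=> ke; have [N [q hq]] := near_step_exists phi k.
  exists (pickle (N, q, k)) => //; rewrite /W pickleK.
  case: asboolP => // nU; exfalso; apply: nU => psi hpsi.
  apply: he => s st; apply: le_lt_trans ke.
  exact: near_step_dist hq hpsi s st.
move=> [n _]; rewrite /W; case: unpickle => // p.
by case: asboolP => // VU; exact: VU.
Qed.

Lemma measurable_borel_cpathP d (T : measurableType d) (g : T -> borel_cpath t) :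
  (forall s, 0 <= s <= t ->
    measurable_fun setT (fun w => cpath_fun (g w : cpath t) s)) ->
  measurable_fun setT g.
Proof.
move=> mg; have mc : measurable_fun [set: T] (g : T -> g_sigma_algebraType cpath_cylinder).
  apply: (@measurability _ _ T (g_sigma_algebraType cpath_cylinder) setT g cpath_cylinder) => //.
  move=> _ [_ [l lt ->] <-]; rewrite setTI.
  elim: l lt => [|p l IH] lt.
    by rewrite (_ : _ @^-1` _ = setT) //; apply/seteqP; split.
  rewrite (_ : _ @^-1` _ = (fun w => cpath_fun (g w : cpath t) p.1) @^-1` [set x | x < p.2] `&`
      g @^-1` [set phi | forall q, q \in l -> cpath_fun phi q.1 < q.2]).
    apply: measurableI; last by apply: IH => q ql; apply: lt; rewrite inE ql orbT.
    have pt : 0 <= p.1 <= t by apply: lt; rewrite inE eqxx.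
    have := mg _ pt measurableT `]-oo, p.2[%classic (measurable_itv _).
    by rewrite setTI.
  apply/seteqP; split => w /=.
    by move=> h; split; [apply: h; rewrite inE eqxx|move=> q ql; apply: h; rewrite inE ql orbT].
  by move=> [h1 h2] q; rewrite inE => /orP[/eqP ->//|]; exact: h2.
move=> _ A mA; apply: mc => //.
move: A mA; apply: smallest_sub; first exact: smallest_sigma_algebra.
exact: open_cpath_cylinder.
Qed.

Lemma cpath_cylinder_measurable (E : set (cpath t)) : cpath_cylinder E ->
  @measurable _ (borel_cpath t) E.
Proof.
move=> [l lt ->]; elim: l lt => [|p l IH] lt.
  by rewrite (_ : mkset _ = setT) //; apply/seteqP; split.
rewrite (_ : mkset _ = [set phi | cpath_fun phi p.1 < p.2] `&`
    [set phi | forall q, q \in l -> cpath_fun phi q.1 < q.2]).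
  apply: measurableI; last by apply: IH => q ql; apply: lt; rewrite inE ql orbT.
  apply: sub_sigma_algebra; apply: cpath_eval_open.
  by apply: lt; rewrite inE eqxx.
apply/seteqP; split => phi /=.
  by move=> h; split; [apply: h; rewrite inE eqxx|move=> q ql; apply: h; rewrite inE ql orbT].
by move=> [h1 h2] q; rewrite inE => /orP[/eqP ->//|]; exact: h2.
Qed.

Lemma borel_cpath_measure_unique (m1 m2 : {measure set (borel_cpath t) -> \bar R}) :
  (m1 setT < +oo)%E -> (forall E, cpath_cylinder E -> m1 E = m2 E) ->
  forall E, measurable E -> m1 E = m2 E.
Proof.
move=> m1oo m12 E mE.
have cE : <<s cpath_cylinder >> E.
  move: E mE; apply: smallest_sub; first exact: smallest_sigma_algebra.
  exact: open_cpath_cylinder.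
have cT (_ : nat) : cpath_cylinder setT.
  by exists [::] => //; apply/seteqP; split.
have cov : \bigcup_(_ : nat) (setT : set (borel_cpath t)) = setT.
  by rewrite bigcup_const//; exists 0%N.
exact: (@g_sigma_algebra_measure_unique _ R (borel_cpath t) cpath_cylinder
  cpath_cylinder_measurable (fun=> setT) cT cov m1 m2 cpath_cylinder_setI m12
  (fun=> m1oo) E cE).
Qed.

End cpath_borel.

(** * From continuous cylinder functionals to indicators of cylinder sets *)

Definition chi {R : realType} (l : seq (R * R)) (f : R -> R) : R :=
  \prod_(p <- l) (f p.1 < p.2)%R%:R.

Section cylinder_indicator.
Context {R : realType}.
Implicit Types (l : seq (R * R)) (f : R -> R).

Lemma ramp_homo (x : R) : {homo (fun m => ramp m x) : a b / (a <= b)%N >-> a <= b}.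
Proof.
move=> a b ab; rewrite /ramp le_min !ge_min lexx orbT andbT; apply/orP; left.
rewrite le_max !ge_max lexx /=.
have [x0|x0] := leP 0 x.
  by apply/orP; right; rewrite mulr_ge0 ?ler0n//= ler_wpM2r ?ler_nat.
by apply/orP; left; rewrite mulr_ge0_le0 ?ler0n// ltW.
Qed.

Lemma ramp_cvg (x : R) : ramp m x @[m --> \oo] --> ((0 < x)%R%:R : R).
Proof.
apply: cvg_near_cst; have [x0|x0] := ltP 0 x; last first.
  apply: nearW => m; rewrite /ramp (max_idPl _) ?(min_idPl _) ?ler01//.
  by rewrite mulr_ge0_le0 ?ler0n.
near=> m.
have mx : 1 <= m%:R * x.
  rewrite -ler_pdivrMr// div1r; near: m; exact: nbhs_infty_ger.
rewrite /ramp (max_idPr _); last exact: le_trans mx.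
by rewrite (min_idPr mx).
Unshelve. all: by end_near. Qed.

Lemma cyl_homo l f : {homo (fun m => cyl m l f) : a b / (a <= b)%N >-> a <= b}.
Proof.
move=> a b ab; rewrite /cyl; elim: l => [|p l IH]; first by rewrite !big_nil.
rewrite !big_cons; apply: ler_pM => //.
- by have /andP[] := ramp01 a (p.2 - f p.1).
- by have /andP[] := cyl01 a l f.
- exact: ramp_homo.
Qed.

Lemma cyl_chi_cvg l f : cyl m l f @[m --> \oo] --> chi l f.
Proof.
rewrite /cyl /chi; elim: l => [|p l IH].
  by under eq_fun do rewrite big_nil; rewrite big_nil; exact: cvg_cst.
under eq_fun do rewrite big_cons; rewrite big_cons.
by apply: cvgM => //; rewrite -subr_gt0; exact: ramp_cvg.
Qed.

Lemma chiE l f : chi l f = (all (fun p => f p.1 < p.2) l)%:R.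
Proof.
rewrite /chi; elim: l => [|p l IH]; first by rewrite big_nil.
by rewrite big_cons IH /= -natrM mulnb.
Qed.

Lemma eq_chi l f g : (forall p, p \in l -> f p.1 = g p.1) -> chi l f = chi l g.
Proof.
move=> fg; rewrite /chi big_seq [RHS]big_seq.
by apply: eq_bigr => p pl; rewrite fg.
Qed.

Lemma measurable_chi d (T : measurableType d) l (u : T -> R -> R) :
  (forall m, measurable_fun setT (fun w => cyl m l (u w))) ->
  measurable_fun setT (fun w => chi l (u w)).
Proof.
move=> mu; apply: (measurable_fun_cvg mu) => w _; exact: cyl_chi_cvg.
Qed.

Lemma cyl_chi_integral d (T : measurableType d) (P : probability T R) l
    (D : T -> R) (u : T -> R -> R) :
  measurable_fun setT D -> (forall w, 0 <= D w) ->
  (forall m, measurable_fun setT (fun w => cyl m l (u w))) ->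
  (\int[P]_w (D w * cyl m l (u w))%:E @[m --> \oo] -->
   \int[P]_w (D w * chi l (u w))%:E)%E.
Proof.
move=> mD D0 mu.
pose g (m : nat) w := (D w * cyl m l (u w))%:E.
have mg m : measurable_fun setT (g m).
  by apply/measurable_EFinP; exact: measurable_funM.
have g0 m w : [set: T] w -> (0 <= g m w)%E.
  by move=> _; rewrite lee_fin mulr_ge0//; have /andP[] := cyl01 m l (u w).
have ndg w : [set: T] w -> {homo g ^~ w : a b / (a <= b)%N >-> (a <= b)%E}.
  by move=> _ a b ab; rewrite lee_fin ler_wpM2l// cyl_homo.
have := cvg_monotone_convergence (mu := P) measurableT mg g0 ndg.
rewrite (_ : (\int[P]_w (D w * chi l (u w))%:E)%E =
    (\int[P]_w limn (g ^~ w))%E)//.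
apply: eq_integral => w _; apply/esym/cvg_lim => //.
apply: cvg_EFin; first exact: nearW.
by apply: cvgM; [exact: cvg_cst|exact: cyl_chi_cvg].
Qed.

End cylinder_indicator.

Section indicator_identity.
Context d (T : measurableType d) (R : realType) (P : probability T R).
Variables (B : brownian_motion P) (t : R).
Hypothesis t0 : 0 < t.
Variables (l : seq (R * R)) (z : R).
Hypothesis lt : forall p, p \in l -> 0 <= p.1 <= t.
Local Notation ED w := (expR (log_density t z (bm_centered B w))).

Let mED : measurable_fun setT (fun w => ED w).
Proof. by apply: measurableT_comp => //; exact: measurable_log_density. Qed.

Let ED0 w : 0 <= ED w. Proof. exact: expR_ge0. Qed.

Lemma chi_identity :
  (\int[P]_w (chi l (transf t z (bm_centered B w)))%:E =
   \int[P]_w (ED w * chi l (bm_centered B w))%:E)%E.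
Proof.
have h2 := cyl_chi_integral (P := P) mED ED0
  (fun m => measurable_cyl_centered B t0 m lt).
have h1 := cyl_chi_integral (P := P) (measurable_cst (1 : R)) (fun _ : T => ler01)
  (fun m => measurable_cyl_transf B t0 m lt z).
have e m : (\int[P]_w (ED w * cyl m l (bm_centered B w))%:E =
    \int[P]_w (1 * cyl m l (transf t z (bm_centered B w)))%:E)%E.
  by rewrite -cylinder_identity//; apply: eq_integral => w _; rewrite mul1r.
rewrite (eq_cvg _ _ e) in h2.
have -> : (\int[P]_w (chi l (transf t z (bm_centered B w)))%:E =
    \int[P]_w (1 * chi l (transf t z (bm_centered B w)))%:E)%E.
  by apply: eq_integral => w _; rewrite mul1r.
exact: cvg_unique h1 h2.
Qed.

Lemma chi_identity_opp :
  (\int[P]_w (chi l (bm_centered B w))%:E =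
   \int[P]_w (ED w * chi l (transf t (- z) (bm_centered B w)))%:E)%E.
Proof.
have h2 := cyl_chi_integral (P := P) mED ED0
  (fun m => measurable_cyl_transf B t0 m lt (- z)).
have h1 := cyl_chi_integral (P := P) (measurable_cst (1 : R)) (fun _ : T => ler01)
  (fun m => measurable_cyl_centered B t0 m lt).
have e m : (\int[P]_w (ED w * cyl m l (transf t (- z) (bm_centered B w)))%:E =
    \int[P]_w (1 * cyl m l (bm_centered B w))%:E)%E.
  by rewrite -cylinder_identity_opp//; apply: eq_integral => w _; rewrite mul1r.
rewrite (eq_cvg _ _ e) in h2.
have -> : (\int[P]_w (chi l (bm_centered B w))%:E =
    \int[P]_w (1 * chi l (bm_centered B w))%:E)%E.
  by apply: eq_integral => w _; rewrite mul1r.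
exact: cvg_unique h1 h2.
Qed.

Lemma measurable_chi_centered :
  measurable_fun setT (fun w => chi l (bm_centered B w)).
Proof. by apply: measurable_chi => m; exact: (measurable_cyl_centered B t0 m lt). Qed.

Lemma measurable_chi_transf x :
  measurable_fun setT (fun w => chi l (transf t x (bm_centered B w))).
Proof. by apply: measurable_chi => m; exact: (measurable_cyl_transf B t0 m lt x). Qed.

End indicator_identity.

Section cpath_functionals.
Context d (T : measurableType d) (R : realType) (P : probability T R) (t : R).
Hypothesis t0 : 0 < t.
Variables (a b : T -> borel_cpath t) (D : T -> R).
Hypotheses (ma : measurable_fun setT a) (mb : measurable_fun setT b).
Hypotheses (mD : measurable_fun setT D) (D0 : forall w, 0 <= D w).

(** Both sides integrate [F] against a measure on the path space: the law of [a], which is finite,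
    and the law of [b] weighted by [D]. Agreement on cylinders makes these measures equal. *)
Lemma ge0_integral_cpath_eq :
  (forall l : seq (R * R), (forall p, p \in l -> (0 <= p.1 <= t)%R) ->
    \int[P]_w (chi l (cpath_fun (a w)))%:E =
    \int[P]_w (D w * chi l (cpath_fun (b w)))%:E)%E ->
  forall F : borel_cpath t -> R, (forall phi, 0 <= F phi) ->
  measurable_fun setT F ->
  (\int[P]_w (F (a w))%:E = \int[P]_w (D w * F (b w))%:E)%E.
Proof.
move=> hl F F0 mF.
have c0 (w : T) : 0 <= cst (1 : R) w by [].
pose m1 := wpush P ma (measurable_cst _) c0.
pose m2 := wpush P mb mD D0.
have m12 E : measurable E -> m1 E = m2 E.
  apply: borel_cpath_measure_unique => //.
    have mT : measurable (a @^-1` setT) by rewrite preimage_setT.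
    rewrite /m1 wpushE (integral_cst P mT 1%E) mul1e.
    exact: (le_lt_trans (probability_le1 P mT) (ltry 1)).
  move=> A cA; have mA := cpath_cylinder_measurable cA.
  have mI : measurable_fun setT (fun phi : borel_cpath t => (\1_A phi : R)%:E).
    by apply/measurable_EFinP; exact: measurable_indic.
  have I0 (phi : borel_cpath t) : (0 <= (\1_A phi : R)%:E)%E by rewrite lee_fin.
  have mE (m : {measure set (borel_cpath t) -> \bar R}) :
      m A = (\int[m]_phi (\1_A phi : R)%:E)%E by rewrite integral_indic// setIT.
  rewrite !mE /m1 /m2 !ge0_integral_wpush//.
  case: cA => l lt AE.
  have AI (phi : borel_cpath t) : \1_A phi = chi l (cpath_fun phi) :> R.
    rewrite chiE indicE; congr (nat_of_bool _)%:R.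
    rewrite AE; apply/idP/idP => [|/allP h]; rewrite inE /=; last exact: h.
    by move=> h; apply/allP.
  transitivity (\int[P]_w (chi l (cpath_fun (a w)))%:E)%E.
    by apply: eq_integral => w _; rewrite mul1e AI.
  by rewrite hl//; apply: eq_integral => w _; rewrite AI EFinM.
have mFE : measurable_fun setT (fun phi => (F phi)%:E) by exact/measurable_EFinP.
have FE0 phi : (0 <= (F phi)%:E)%E by rewrite lee_fin.
transitivity (\int[m1]_phi (F phi)%:E)%E.
  rewrite /m1 ge0_integral_wpush//.
  by apply: eq_integral => w _; rewrite mul1e.
transitivity (\int[m2]_phi (F phi)%:E)%E.
  by apply: eq_measure_integral => A mA _; exact: m12.
rewrite /m2 ge0_integral_wpush//.
Qed.

End cpath_functionals.

(** * The theorem *)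

(** Links functionals of [B] to those of [B - B_0] for every [w]: measurability and positivity are
    pointwise matters, while [B_0 = 0] holds only almost surely. *)
Lemma expA_shift (R : realType) (t : R) (f : R -> R) (c s : R) :
  {within `[0, t], continuous f} -> s <= t ->
  expA (fun u => f u + c) s = expR (2 * c) * expA f s.
Proof.
move=> cf st.
have ist : lebesgue_measure.-integrable `[0, s] (EFin \o (fun u => expR (2 * f u))).
  by apply: (integrableS _ _ _ (exp2_integrable_path cf)) => //; exact: subset_itvl.
rewrite /expA -RintegralZl//.
by apply: eq_Rintegral => u _; rewrite -expRD mulrDr addrC.
Qed.

Section path_functionals.
Context d (T : measurableType d) (R : realType) (P : probability T R).
Variables (B : brownian_motion P) (t : R).
Hypothesis t0 : 0 < t.
Local Notation dt n := (t / n.+1%:R).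

Lemma cpath_fun_bm_path w s : 0 <= s <= t -> cpath_fun (bm_path B t w) s = B s w.
Proof.
move=> st; have sI : s \in [set` `[0, t]] by rewrite inE /= in_itv.
exact: (cpath_fun_val (bm_path B t w) (SigSub sI)).
Qed.

Lemma eq_expA (f g : R -> R) s : s <= t ->
  (forall u, 0 <= u <= t -> f u = g u) -> expA f s = expA g s.
Proof.
move=> st fg; apply: eq_Rintegral => u; rewrite inE /= in_itv/= => /andP[u0 us].
by rewrite fg// u0 (le_trans us).
Qed.

Lemma cpath_fun_transform z (phi : cpath t) s : 0 <= s <= t ->
  cpath_fun (transform z phi) s = transf t z (cpath_fun phi) s.
Proof.
move=> st; have sI : s \in [set` `[0, t]] by rewrite inE /= in_itv.
exact: (cpath_fun_val (transform z phi) (SigSub sI)).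
Qed.

Lemma eq_transf z (f g : R -> R) s : 0 <= s <= t ->
  (forall u, 0 <= u <= t -> f u = g u) -> transf t z f s = transf t z g s.
Proof.
move=> /andP[s0 st] fg; have fgs : f s = g s by apply: fg; rewrite s0.
by rewrite /transf (eq_expA st fg) (eq_expA (lexx t) fg) fgs.
Qed.

(** Measurability in [w] is inherited from the grid sums [gA], which converge pointwise to the
    integral. *)
Lemma measurable_expA_centered s : 0 <= s <= t ->
  measurable_fun setT (fun w => expA (bm_centered B w) s).
Proof.
move=> st.
apply: (measurable_fun_cvg (h := fun n w =>
  gA (dt n) (bm_grid B (dt n) n.+1 w) (grid_index t n s))).
  move=> n; apply: (measurableT_comp (measurable_gA _ _)).
  by apply: measurable_bm_grid_seq; rewrite divr_gt0.
move=> w _; under eq_fun do rewrite bm_grid_ygrid.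
apply: gA_index_cvg => //; last exact: bm_centered0.
exact: bm_centered_continuous.
Qed.

Lemma expA_bmE w s : 0 <= s <= t ->
  expA (fun u => B u w) s = expR (2 * B 0 w) * expA (bm_centered B w) s.
Proof.
move=> /andP[_ st].
have -> : (fun u => B u w) = (fun u => bm_centered B w u + B 0 w).
  by apply/funext => u; rewrite subrK.
by apply: (expA_shift (t := t)) => //; exact: bm_centered_continuous.
Qed.

Lemma measurable_expA_bm s : 0 <= s <= t ->
  measurable_fun setT (fun w => expA (fun u => B u w) s).
Proof.
move=> st; under eq_fun do rewrite expA_bmE//.
apply: measurable_funM; last exact: measurable_expA_centered.
apply: measurableT_comp => //; apply: measurable_funM => //.
exact: bm_measurable.
Qed.

Lemma expA_bm_gt0 w : 0 < expA (fun u => B u w) t.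
Proof.
rewrite expA_bmE ?lexx ?ltW// mulr_gt0 ?expR_gt0//.
apply: expA_gt0 => //; last exact: bm_centered0.
exact: bm_centered_continuous.
Qed.

Lemma measurable_bm_path : measurable_fun setT (bm_path B t : T -> borel_cpath t).
Proof.
apply: measurable_borel_cpathP => // s st.
under eq_fun do rewrite cpath_fun_bm_path//.
by apply: bm_measurable; have /andP[] := st.
Qed.

Lemma measurable_transform_bm_path z :
  measurable_fun setT (fun w => transform z (bm_path B t w) : borel_cpath t).
Proof.
apply: measurable_borel_cpathP => // s st.
have e w : cpath_fun (transform z (bm_path B t w)) s =
    transf t z (fun u => B u w) s.
  rewrite (cpath_fun_transform z (bm_path B t w) st).
  by apply: (eq_transf z st) => u; exact: cpath_fun_bm_path.
under eq_fun do rewrite e.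
have tt : 0 <= t <= t by rewrite lexx ltW.
apply: measurable_funB; first by apply: bm_measurable; have /andP[] := st.
apply: measurableT_comp => //; apply: measurable_funD => //.
apply: measurable_funM => //; apply: measurable_funM.
  exact: measurable_expA_bm.
by apply: measurable_funVr; [exact: expA_bm_gt0|exact: measurable_expA_bm].
Qed.

Definition bm_density (z : R) (w : T) : R :=
  expR ((cosh (B t w) - cosh (z + B t w)) / expZ (fun s => B s w) t).

Lemma measurable_bm_density z : measurable_fun setT (bm_density z).
Proof.
have mBt : measurable_fun setT (B t) by apply: bm_measurable; exact: ltW.
apply: measurableT_comp => //; apply: measurable_funM.
  apply: measurable_funB; apply: (measurableT_comp (@measurable_cosh R)) => //.
  exact: measurable_funD.
apply: measurable_funVr.
  by move=> w; rewrite mulr_gt0 ?expR_gt0// expA_bm_gt0.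
apply: measurable_funM; last by apply: measurable_expA_bm; rewrite lexx ltW.
by apply: measurableT_comp => //; exact: measurable_funN.
Qed.

Lemma bm_centeredE w : B 0 w = 0 -> bm_centered B w = (fun s => B s w).
Proof. by move=> w0; apply/funext => s; rewrite /bm_centered w0 subr0. Qed.

Lemma bm_densityE z w : B 0 w = 0 ->
  bm_density z w = expR (log_density t z (bm_centered B w)).
Proof. by move=> /bm_centeredE ->; rewrite /bm_density /log_density (addrC z). Qed.

Lemma chi_bm_path l w : (forall p, p \in l -> 0 <= p.1 <= t) -> B 0 w = 0 ->
  chi l (cpath_fun (bm_path B t w)) = chi l (bm_centered B w).
Proof.
move=> lt /bm_centeredE ->; apply: eq_chi => p /lt pt.
exact: cpath_fun_bm_path.
Qed.

Lemma chi_transform_bm_path l z w :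
  (forall p, p \in l -> 0 <= p.1 <= t) -> B 0 w = 0 ->
  chi l (cpath_fun (transform z (bm_path B t w))) =
  chi l (transf t z (bm_centered B w)).
Proof.
move=> lt /bm_centeredE ->; apply: eq_chi => p /lt pt.
rewrite (cpath_fun_transform z (bm_path B t w) pt).
by apply: (eq_transf z pt) => u; exact: cpath_fun_bm_path.
Qed.

Lemma measurable_chi_cpath l (a : T -> borel_cpath t) :
  (forall p, p \in l -> 0 <= p.1 <= t) -> measurable_fun setT a ->
  measurable_fun setT (fun w => chi l (cpath_fun (a w : cpath t))).
Proof.
move=> lt ma.
have -> : (fun w => chi l (cpath_fun (a w : cpath t))) =
    (fun w => \1_[set phi : cpath t | forall p, p \in l -> cpath_fun phi p.1 < p.2] (a w)).
  apply/funext => w; rewrite chiE indicE; congr (nat_of_bool _)%:R.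
  apply/idP/idP => [/allP h|]; rewrite inE /=; first exact: h.
  by move=> h; apply/allP.
apply: (measurableT_comp _ ma); apply: measurable_indic.
by apply: cpath_cylinder_measurable; exists l.
Qed.

Lemma ae_eq_integral_start (f g : T -> R) :
  measurable_fun setT f -> measurable_fun setT g ->
  (forall w, B 0 w = 0 -> f w = g w) ->
  (\int[P]_w (f w)%:E = \int[P]_w (g w)%:E)%E.
Proof.
move=> mf mg fg; apply: ae_eq_integral => //; try exact/measurable_EFinP.
have := bm_start B; apply: filterS => w w0 _.
by rewrite fg.
Qed.

End path_functionals.

Theorem theorem1p2 (R : realType) (d : measure_display) (T : measurableType d)
    (P : probability T R) (B : brownian_motion P) (t : R) (ht : 0 < t) (z : R)
    (F : borel_cpath t -> R) (F0 : forall phi, 0 <= F phi)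
    (mF : measurable_fun [set: borel_cpath t] F) :
  ('E_P[fun w => F (transform z (bm_path B t w))] =
   'E_P[fun w =>
     (expR ((cosh (B t w) - cosh (z + B t w)) / expZ (fun s => B s w) t)
      * F (bm_path B t w))%R])%E
  /\
  ('E_P[fun w => F (bm_path B t w)] =
   'E_P[fun w =>
     (expR ((cosh (B t w) - cosh (z + B t w)) / expZ (fun s => B s w) t)
      * F (transform (- z) (bm_path B t w)))%R])%E.
Proof.
have mB := measurable_bm_path B ht.
have mT x := measurable_transform_bm_path B ht x.
have mD := measurable_bm_density B ht z.
have D0 w : 0 <= bm_density B t z w by exact: expR_ge0.
rewrite !unlock; split.
(* It remains to treat cylinder indicators, where [B] and [B - B_0] can be exchanged almost
   surely. *)
- apply: (ge0_integral_cpath_eq ht (mT z) mB mD D0 _ F0 mF) => l lt.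
  rewrite (ae_eq_integral_start (B := B)
    (g := fun w => chi l (transf t z (bm_centered B w)))); last first.
  + by move=> w; exact: chi_transform_bm_path.
  + exact: (measurable_chi_transf B ht lt z).
  + exact: (measurable_chi_cpath lt (mT z)).
  rewrite chi_identity//; apply: (ae_eq_integral_start (B := B)).
  + apply: measurable_funM; last exact: (measurable_chi_centered B ht lt).
    by apply: measurableT_comp => //; exact: (measurable_log_density B ht z).
  + apply: measurable_funM => //; exact: measurable_chi_cpath.
  + by move=> w w0; rewrite bm_densityE// chi_bm_path.
- apply: (ge0_integral_cpath_eq ht mB (mT (- z)) mD D0 _ F0 mF) => l lt.
  rewrite (ae_eq_integral_start (B := B)
    (g := fun w => chi l (bm_centered B w))); last first.
  + by move=> w; exact: chi_bm_path.
  + exact: (measurable_chi_centered B ht lt).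
  + exact: (measurable_chi_cpath lt mB).
  rewrite (chi_identity_opp B ht z lt); apply: (ae_eq_integral_start (B := B)).
  + apply: measurable_funM; last exact: (measurable_chi_transf B ht lt (- z)).
    by apply: measurableT_comp => //; exact: (measurable_log_density B ht z).
  + apply: measurable_funM => //; exact: measurable_chi_cpath.
  + by move=> w w0; rewrite bm_densityE// chi_transform_bm_path.
Qed.
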